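(* Let $W=(W_{mn})_{m,n\in\mathbb{Z}}$ be an infinite Hermitian matrix with complex entries, regarded as a linear operator on $\ell^2=\ell^2(\mathbb{Z})$, such that: (1) $\|W\|<\infty$; (2) there is a positive integer $k$ such that each row of $W$ has at most $k$ non-zero elements; (3) $\inf\sigma(W)\ge 0$, where $\sigma(W)$ is the spectrum of $W$ as an operator on $\ell^2$. Let $D=(D_{mn})_{m,n\in\mathbb{Z}}$ be a Hermitian matrix and, for integers $P,Q>0$, let $W_{PQ}$ be the $(P+Q+1)\times(P+Q+1)$ matrix with indices $m,n$ in the range $[-P,Q]$ defined by $$(W_{PQ})_{mn}=W_{mn}\quad\text{if } -P<m<Q \text{ or } -P<n<Q,$$ $$(W_{PQ})_{mn}=W_{mn}+D_{mn}\quad\text{if } m,n\in\{-P,Q\}.$$ Suppose that there is a constant $d\ge 0$ such that for all integers $P,Q>0$: (i) $W_{PQ}\ge\inf\sigma(W)$, i.e. the lowest eigenvalue of $W_{PQ}$ is greater than or equal to $\inf\sigma(W)$; (ii) $\|W_{PQ}\|\le\|W\|+d$. Let $\alpha\in\mathbb{R}$ be arbitrary if $\inf\sigma(W)>0$, and let $\alpha\ge 0$ if $\inf\sigma(W)=0$. Then for every fixed pair of indices $m,n\in\mathbb{Z}$, $$\lim_{P,Q\to\infty}(W_{PQ}^{\alpha})_{mn}=(W^{\alpha})_{mn}.$$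
   Context: $\ell^2=\ell^2(\mathbb{Z})$ is the Hilbert space of square-summable complex sequences indexed by $\mathbb{Z}$, with canonical orthonormal basis $(e_n)_{n\in\mathbb{Z}}$. An infinite matrix $W$ is identified with a linear operator on $\ell^2$ via $W_{mn}=(We_n\,|\,e_m)$. $\|W\|$ denotes the operator norm on $\ell^2$; $\|W_{PQ}\|$ denotes the operator norm of $W_{PQ}$ acting on $\mathbb{C}_{PQ}\cong\mathbb{C}^{P+Q+1}$, the space of complex sequences indexed by $-P,\dots,Q$ with its standard inner product. The power $W^\alpha$ is the real power of the non-negative bounded self-adjoint operator $W$ given by the functional calculus (function $\lambda\mapsto\lambda^\alpha$ on the spectrum; $\alpha=0$ gives the identity), and $(W^\alpha)_{mn}$ is its matrix element $(W^\alpha e_n\,|\,e_m)$. Likewise $W_{PQ}^\alpha$ is the real power of the Hermitian matrix $W_{PQ}$, taken as an operator on $\mathbb{C}_{PQ}$ (not extended by zero to $\ell^2$). For fixed $m,n$, the element $(W_{PQ}^\alpha)_{mn}$ is defined once $-P\le m,n\le Q$. The limit $P,Q\to\infty$ means that both $P$ and $Q$ tend to infinity jointly (independently of each other). *)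

(* Defs.v *)
From HB Require Import structures.
From mathcomp Require Import all_boot all_order all_algebra.
From mathcomp Require Import all_classical all_reals all_analysis.
From mathcomp Require Import complex ring.

Set Implicit Arguments.
Unset Strict Implicit.
Unset Printing Implicit Defensive.

Import Order.TTheory GRing.Theory Num.Theory.
Import numFieldNormedType.Exports.

Local Open Scope classical_set_scope.
Local Open Scope ring_scope.

(* Declared at type numClosedFieldType so that the complex numbers carry the
   topology that MathComp-Analysis attaches to every numFieldType. *)
Definition Cplx (R : realType) : numClosedFieldType := R[i].

Definition ofR (R : realType) (a : R) : Cplx R := a%:C%C.

Definition reC (R : realType) (z : Cplx R) : R := complex.Re z.

Definition absC (R : realType) (z : Cplx R) : R := reC `|z|.

Section AbsC.
Variable R : realType.
Implicit Types a y z : Cplx R.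

Lemma absC_normc z : absC z = ComplexField.Normc.normc z.
Proof. by []. Qed.

Lemma absC_ge0 z : 0 <= absC z.
Proof. by rewrite absC_normc; case: z => a b; exact: sqrtr_ge0. Qed.

Lemma absCM a z : absC (a * z) = absC a * absC z.
Proof. by rewrite !absC_normc ComplexField.Normc.normcM. Qed.

Lemma absC0 : absC (0 : Cplx R) = 0.
Proof. by rewrite absC_normc ComplexField.Normc.normc0. Qed.

Lemma absCD y z : absC (y + z) <= absC y + absC z.
Proof. by rewrite !absC_normc; exact: le_normcD. Qed.

End AbsC.

Section Ell2.
Variable R : realType.
Notation C := (Cplx R).

Definition sqsum (x : int -> C) : \bar R :=
  (\esum_(n in [set: int]) (absC (x n) ^+ 2)%:E)%E.

Lemma sqsum_linear (a : C) (x y : int -> C) :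
  (sqsum (a *: x + y)%R <=
     (2 * absC a ^+ 2)%:E * sqsum x + 2%:E * sqsum y)%E.
Proof.
have lin (c : R) (u : int -> C) : 0 <= c ->
   (\esum_(n in [set: int]) (c * absC (u n) ^+ 2)%:E <= c%:E * sqsum u)%E.
  move=> c_ge0; apply: ge_ereal_sup => _ [A [finA _] <-].
  rewrite (eq_fsbigr (fun n => c%:E * (absC (u n) ^+ 2)%:E)%E); last first.
    by move=> n _; rewrite EFinM.
  rewrite -ge0_mule_fsumr; last by move=> n; rewrite lee_fin sqr_ge0.
  rewrite lee_wpmul2l ?lee_fin //.
  by apply: ereal_sup_ubound; exists A.
have c0 : 0 <= 2 * absC a ^+ 2 by rewrite mulr_ge0 ?sqr_ge0.
apply: (le_trans _ (leeD (lin _ x c0) (lin 2 y _))) => //.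
rewrite -esumD; last 2 first.
- by move=> n _; rewrite lee_fin mulr_ge0 ?sqr_ge0.
- by move=> n _; rewrite lee_fin mulr_ge0 ?sqr_ge0.
apply: le_esum => n _; rewrite -EFinD lee_fin.
apply: (@le_trans _ _ ((absC (a * x n) + absC (y n)) ^+ 2)).
  by rewrite lerXn2r ?nnegrE ?addr_ge0 ?absC_ge0 //; exact: absCD.
rewrite absCM -subr_ge0.
rewrite [leRHS](_ : _ = (absC a * absC (x n) - absC (y n)) ^+ 2) ?sqr_ge0 //.
by ring.
Qed.

Definition ell2_pred : {pred int -> C} := fun x => `[< (sqsum x < +oo)%E >].

Lemma ell2_submod_closed : submod_closed ell2_pred.
Proof.
split=> [|a x y /asboolP x2 /asboolP y2]; apply/asboolP.
  by rewrite /sqsum esum1 // => n _; rewrite /= absC0 expr0n.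
apply: (le_lt_trans (sqsum_linear a x y)).
apply: lte_add_pinfty; apply: lte_mul_pinfty => //.
by rewrite lee_fin mulr_ge0 ?sqr_ge0.
Qed.

HB.instance Definition _ :=
  GRing.isSubmodClosed.Build C (int -> C) ell2_pred ell2_submod_closed.

Record ell2 := Ell2 { ell2_fun :> int -> C; _ : ell2_fun \in ell2_pred }.

HB.instance Definition _ := [isSub for ell2_fun].
HB.instance Definition _ := [Choice of ell2 by <:].
HB.instance Definition _ := [SubChoice_isSubLmodule of ell2 by <:].

Definition delta (n : int) : int -> C := fun m => (m == n)%:R.

Lemma delta_ell2 n : delta n \in ell2_pred.
Proof.
apply/asboolP; rewrite /sqsum (esumID [set n]); last first.
  by move=> m _; rewrite lee_fin sqr_ge0.
rewrite setTI esum_set1 ?lee_fin ?sqr_ge0 // [X in (_ + X)%E]esum1 ?adde0 ?ltry //.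
by move=> m [_ /= /eqP/negbTE mn]; rewrite /delta mn absC0 expr0n.
Qed.

Definition ell2_basis (n : int) : ell2 := Ell2 (delta_ell2 n).

Definition ell2_norm (x : ell2) : R := Num.sqrt (fine (sqsum x)).

(* \sum_(n in Z) x_n * conj (y_n), which converges absolutely on ell2 *)
Definition ell2_dot (x y : ell2) : C :=
  limn (fun N : nat =>
    \sum_(i < N.*2.+1) x (i%:Z - N%:Z) * (y (i%:Z - N%:Z))^*).

Definition opnorm (T : ell2 -> ell2) : \bar R :=
  ereal_sup [set (ell2_norm (T x))%:E | x in [set x | ell2_norm x <= 1]].

Definition mxelt (T : ell2 -> ell2) (m n : int) : C :=
  ell2_dot (T (ell2_basis n)) (ell2_basis m).

Definition hermitianZ (A : int -> int -> C) : Prop :=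
  forall m n, A m n = (A n m)^*.

Definition row_sparse (k : nat) (A : int -> int -> C) : Prop :=
  forall m, ([set n | A m n != 0] #<= `I_k)%card.

Definition resolvent_set (T : ell2 -> ell2) : set C :=
  [set z | exists S : {linear ell2 -> ell2},
    [/\ (opnorm S < +oo)%E,
        forall x, S (T x - z *: x) = x &
        forall x, T (S x) - z *: S x = x]].

Definition spectrum (T : ell2 -> ell2) : set C := ~` resolvent_set T.

(* Meant for bounded self-adjoint T, whose spectrum is real, compact and
   non-empty, so that the default value of inf does not occur. *)
Definition inf_spectrum (T : ell2 -> ell2) : R :=
  inf [set a : R | spectrum T (ofR a)].

Definition polyop (p : {poly R}) (T : ell2 -> ell2) : ell2 -> ell2 :=
  fun x => \sum_(i < size p) ofR p`_i *: iter i T x.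

(* Continuous functional calculus of a bounded self-adjoint operator T: for f
   continuous on the spectrum, f(T) is the limit in operator norm of p(T), for
   real polynomials p converging to f uniformly on the spectrum of T. *)
Definition is_funcalc (f : R -> R) (T S : ell2 -> ell2) : Prop :=
  [/\ linear S, (opnorm S < +oo)%E &
      forall eps : R, 0 < eps -> exists p : {poly R},
        (forall a, spectrum T (ofR a) -> `|p.[a] - f a| <= eps) /\
        (opnorm (fun x => polyop p T x - S x)%R <= eps%:E)%E].

Definition funcalc (f : R -> R) (T : ell2 -> ell2) : ell2 -> ell2 :=
  xget (fun=> 0) [set S | is_funcalc f T S].

(* powR satisfies 0 `^ 0 = 1, and 0 `^ alpha = 0 for alpha > 0 *)
Definition oppow (T : ell2 -> ell2) (alpha : R) : ell2 -> ell2 :=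
  funcalc (fun a => a `^ alpha) T.

End Ell2.

Section FiniteMatrices.
Variable R : realType.
Notation C := (Cplx R).

Definition vec_norm n (x : 'cV[C]_n) : R :=
  Num.sqrt (\sum_(i < n) absC (x i ord0) ^+ 2).

Definition mx_opnorm n (A : 'M[C]_n) : \bar R :=
  ereal_sup [set (vec_norm (A *m x))%:E | x in [set x | vec_norm x <= 1]].

(* For Hermitian A, A = P^-1 diag(l) P with P unitary and l real. *)
Definition mxpow n (A : 'M[C]_n) (alpha : R) : 'M[C]_n :=
  invmx (spectralmx A)
    *m diag_mx (map_mx (fun l => ofR (reC l `^ alpha)) (spectral_diag A))
    *m spectralmx A.

(* The index i : 'I_(P + Q).+1 stands for the integer i - P in [-P, Q]. *)
Definition window (P Q : nat) (W D : int -> int -> C) : 'M[C]_((P + Q).+1) :=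
  \matrix_(i, j)
    let m := i%:Z - P%:Z in let n := j%:Z - P%:Z in
    if (- P%:Z < m < Q%:Z) || (- P%:Z < n < Q%:Z) then W m n
    else W m n + D m n.

(* Meaningful only when m and n both lie in [-P, Q]. *)
Definition window_elt (P Q : nat) (A : 'M[C]_((P + Q).+1)) (m n : int) : C :=
  A (inord (absz (m + P%:Z))) (inord (absz (n + P%:Z))).

End FiniteMatrices.

(* Main.v *)
Require Import Defs.
From HB Require Import structures.
From mathcomp Require Import all_boot all_order all_algebra.
From mathcomp Require Import all_classical all_reals all_analysis.
From mathcomp Require Import complex ring lra zify.

(** Truncation is exact on polynomials. Rows and columns of W have finitely many
    non-zero entries, so for a finitely supported x the vectors x, W x, ...,
    W^d x all live in one bounded interval of indices, and a larger window acts
    on them as W does: its altered corner entries are never met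
    ([restr_opoly]). Hence p(W_PQ)_mn = p(W)_mn for every polynomial p as soon
    as P and Q are large.

    The eigenvalues of all windows lie in one segment [a, b] with a the infimum
    of the spectrum of W, and t ^ alpha is continuous on it. Take a polynomial q
    within e of t ^ alpha on [a, b] ([weierstrass]). Diagonalising the window
    shows that q(W_PQ) is within e of W_PQ ^ alpha, so it remains to see that
    q(W) is within e of W ^ alpha ([funcalcP]); [mxfun_window_cvg] assembles the
    three comparisons.

    The power of W is defined through polynomials that approximate t ^ alpha on
    the spectrum of W, so two facts about this spectrum are needed, and the
    windows yield both. The tool is a quadrature formula ([quadrature]): for x
    finitely supported and p of bounded degree, |p(W) x|^2 is the sum of
    w_i |p(t_i)|^2 for fixed nodes t_i in [a, b] and weights w_i >= 0, namely the
    eigenvalues of a large window and the weights of x in its eigenbasis.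

    First, the norm of p(W) is at most the maximum of |p| on [a, b], so every
    continuous function on [a, b] can be applied to W as a limit of polynomials
    ([operator_limit]). Applied to 1 / (t - c) this gives resolvents, so the
    spectrum is contained in [a, b] ([spectrum_sub]) and the limit for t ^ alpha
    is a functional calculus of W.

    Secondly, that calculus is unique because for real r the norm of r(W) is
    bounded by |r| on the spectrum alone ([spectral_bound]): if M, the norm of
    r(W), were larger, all factors of r^2 - M^2 over the complex numbers would
    give operators bounded below, whereas a symmetric operator of norm M has
    approximate eigenvectors of its square for M^2. *)

Set Implicit Arguments.
Unset Strict Implicit.
Unset Printing Implicit Defensive.

Import Order.TTheory GRing.Theory Num.Theory.
Import numFieldNormedType.Exports.

Local Open Scope classical_set_scope.
Local Open Scope ring_scope.

(** * Polynomial approximation on a segment *)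

Section Weierstrass.
Variable R : realType.
Implicit Types (f g : R -> R) (a b c s u h x y : R).

(** Continuity is taken relative to the segment because [powR] equals 1 at
    negative numbers, so that for alpha > 0 the power t ^ alpha is not
    continuous at 0 on the line. *)
Definition cont_on a b f := forall x, a <= x <= b -> forall e : R, 0 < e ->
  exists2 r : R, 0 < r & forall y, a <= y <= b -> `|x - y| < r -> `|f x - f y| <= e.

(** De Casteljau's form of the Bernstein polynomials: [casteljau f u h n s] is
    the sum over k of C(n, k) u^k (1 - u)^(n - k) f(s + k h). The recursion
    replaces the binomial identities by one-line inductions. *)
Fixpoint casteljau f u h n s : R :=
  if n is m.+1 then (1 - u) * casteljau f u h m s + u * casteljau f u h m (s + h)
  else f s.

Fixpoint casteljau_poly f (u : {poly R}) h n s : {poly R} :=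
  if n is m.+1 then (1 - u) * casteljau_poly f u h m s + u * casteljau_poly f u h m (s + h)
  else (f s)%:P.

Lemma horner_casteljau f (u : {poly R}) h n s x :
  (casteljau_poly f u h n s).[x] = casteljau f u.[x] h n s.
Proof. by elim: n s => [|n IH] s /=; rewrite !hornerE // !IH. Qed.

(** Mean and variance of the binomial law: the grid point s + k h has mean
    s + n h u and variance n h^2 u (1 - u). *)
Lemma casteljau_moment u h n s x e c :
  casteljau (fun t => e + c * (t - x) ^+ 2) u h n s =
  e + c * ((s + n%:R * (h * u) - x) ^+ 2 + n%:R * h ^+ 2 * (u * (1 - u))).
Proof.
elim: n s => [|n IH] s /=; first by rewrite !mul0r !addr0.
by rewrite !IH -natr1; ring.
Qed.

(** The operator is an average over grid points, so it preserves pointwise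
    bounds; only the grid has to lie in the segment. *)
Lemma casteljau_dist f g u h n s y a b : 0 <= u <= 1 -> 0 <= h ->
    a <= s -> s + n%:R * h <= b ->
    (forall t, a <= t <= b -> `|f t - y| <= g t) ->
  `|casteljau f u h n s - y| <= casteljau g u h n s.
Proof.
move=> /andP[u0 u1] h0; elim: n s => [|n IH] s /= sa sb fg.
  by apply: fg; rewrite sa; lra.
move: sb; rewrite -natr1 => sb.
have n0 : (0 : R) <= n%:R * h by rewrite mulr_ge0.
have H1 := IH s sa ltac:(lra) fg.
have H2 := IH (s + h) ltac:(lra) ltac:(lra) fg.
set p := casteljau f u h n s in H1 *; set q := casteljau f u h n (s + h) in H2 *.
rewrite (_ : _ - y = (1 - u) * (p - y) + u * (q - y)); last by ring.
apply: (le_trans (ler_normD _ _)); rewrite !normrM.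
have -> : `|1 - u| = 1 - u by rewrite ger0_norm // subr_ge0.
by rewrite (ger0_norm u0); apply: lerD; rewrite ler_wpM2l // subr_ge0.
Qed.

Lemma cont_on_bounded a b f : cont_on a b f ->
  exists M, forall x, a <= x <= b -> `|f x| <= M.
Proof.
move=> fc.
have cov : forall x, `[a, b]%classic x -> \forall x' \near x & M \near pinfty_nbhs R,
  a <= x' <= b -> `|f x'| <= M.
  move=> x /=; rewrite in_itv/= => xab.
  have [r r0 Hr] := fc x xab 1 ltac:(lra).
  exists (ball x r, [set M | `|f x| + 1 < M]) => /=.
    by split; [exact: nbhsx_ballx|exists (`|f x| + 1); rewrite num_real].
  move=> [z M] /= [zr HM] zab; have := Hr z zab zr.
  by have := ler_normD (f x) (f z - f x); rewrite addrC subrK distrC; lra.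
have [M [_ HM]] : \forall M \near pinfty_nbhs R,
    `[a, b]%classic `<=` (fun M x => a <= x <= b -> `|f x| <= M) M.
  exact: (iffLR (compact_near_coveringP _) (@segment_compact R a b) _ _ _ _ cov).
exists (M + 1) => x xab; by apply: HM => //=; rewrite ?in_itv/= ?xab // ltrDl.
Qed.

(** Uniform continuity in the form that pairs with a second moment: nearby
    points are controlled by e, distant ones by the bound on f, which a large
    multiple of the squared distance absorbs. *)
Lemma cont_on_quadratic a b f (e : R) : 0 < e -> cont_on a b f ->
  exists2 c : R, 0 <= c & forall x y, a <= x <= b -> a <= y <= b ->
    `|f x - f y| <= e + c * (x - y) ^+ 2.
Proof.
move=> e0 fc; have [M HM] := cont_on_bounded fc.
have cov : forall x, `[a, b]%classic x -> \forall x' \near x & c \near pinfty_nbhs R,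
  a <= x' <= b -> forall y, a <= y <= b ->
    `|f y - f x'| <= e + c * (y - x') ^+ 2.
  move=> x /=; rewrite in_itv/= => xab.
  have [r r0 Hr] := fc x xab (e / 2) ltac:(lra).
  exists (ball x (r / 2), [set c | 2 * M / (r / 2) ^+ 2 < c]) => /=.
    split; first by apply: nbhsx_ballx; lra.
    by exists (2 * M / (r / 2) ^+ 2); rewrite num_real.
  move=> [z c] /= [zr /ltW cM] zab y yab.
  have M0 : 0 <= M by apply: le_trans (HM _ xab).
  have r20 : 0 < (r / 2) ^+ 2 by rewrite exprn_gt0 //; lra.
  have c0 : 0 <= c by apply: le_trans cM; rewrite divr_ge0 ?(ltW r20) // mulr_ge0.
  have [yz|yz] := ltP `|y - z| (r / 2).
    have H1 : `|f x - f z| <= e / 2 by apply: Hr => //; apply: lt_trans zr _; lra.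
    have H2 : `|f x - f y| <= e / 2.
      apply: Hr => //; have := ler_distD z x y; move: zr yz; rewrite /ball/= (distrC z y).
      lra.
    have := ler_distD (f x) (f y) (f z); rewrite (distrC (f y) (f x)) => H3.
    have : 0 <= c * (y - z) ^+ 2 by rewrite mulr_ge0 // sqr_ge0.
    lra.
  have H : 2 * M <= c * (y - z) ^+ 2.
    apply: (@le_trans _ _ (c * (r / 2) ^+ 2)); first by rewrite -ler_pdivrMr.
    rewrite ler_wpM2l // -(real_normK (num_real (y - z))) lerXn2r // nnegrE //; lra.
  have := ler_normB (f y) (f z); have := HM _ yab; have := HM _ zab; lra.
have [c [_ Hc]] : \forall c \near pinfty_nbhs R,
    `[a, b]%classic `<=` (fun c x => a <= x <= b -> forall y, a <= y <= b ->
    `|f y - f x| <= e + c * (y - x) ^+ 2) c.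
  exact: (iffLR (compact_near_coveringP _) (@segment_compact R a b) _ _ _ _ cov).
exists (`|c| + 1); first by rewrite addr_ge0.
by move=> x y xab yab; apply: Hc => //=; rewrite ?in_itv//= ltr_pwDr // ler_norm.
Qed.

(** With u = (x - a) / (b - a) and h = (b - a) / (n + 1) the grid has mean x, so that
    [cont_on_quadratic] leaves only the variance, of order 1 / n. *)
Lemma weierstrass a b f (e : R) : a < b -> 0 < e -> cont_on a b f ->
  exists p : {poly R}, forall x, a <= x <= b -> `|p.[x] - f x| <= e.
Proof.
move=> ab e0 fc; have [c c0 Hc] := cont_on_quadratic (divr_gt0 e0 (ltr0n _ 2)) fc.
have ba0 : 0 < b - a by rewrite subr_gt0.
have [n Hn] : exists n : nat, c * (b - a) ^+ 2 < n.+1%:R * (e / 2).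
  have H : 0 <= c * (b - a) ^+ 2 / (e / 2) by rewrite divr_ge0 ?mulr_ge0 ?sqr_ge0 //; lra.
  have := archi_boundP H; set k := Num.bound _ => Hk.
  exists k; rewrite -ltr_pdivrMr ?divr_gt0 //; apply: (lt_trans Hk).
  by rewrite ltr_nat.
have n0 : (0 : R) < n.+1%:R by rewrite ltr0n.
pose h := (b - a) / n.+1%:R.
exists (casteljau_poly f ((b - a)^-1 *: ('X - a%:P)) h n.+1 a) => x xab.
rewrite horner_casteljau !hornerE; set u := _ * (x - a).
have u01 : 0 <= u <= 1.
  by rewrite /u mulrC divr_ge0 ?ler_pdivrMr //=; lra.
have nh : n.+1%:R * h = b - a by rewrite /h mulrC divfK // gt_eqF.
have ub : (b - a) * u = x - a by rewrite /u mulrA mulfV ?mul1r // gt_eqF.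
have h0 : 0 <= h by rewrite divr_ge0 // ltW.
have := @casteljau_dist f (fun t => e / 2 + c * (t - x) ^+ 2) u h n.+1 a (f x) a b
  u01 h0 (lexx _).
rewrite casteljau_moment => H.
apply: (le_trans (H _ _)).
- by rewrite nh; lra.
- by move=> t tab; apply: Hc.
have -> : a + n.+1%:R * (h * u) - x = 0 by rewrite mulrA nh ub; ring.
have -> : c * (0 ^+ 2 + n.+1%:R * h ^+ 2 * (u * (1 - u))) =
    (c * (b - a) ^+ 2 / n.+1%:R) * (u * (1 - u)).
  by rewrite /h; move: n0; set m : R := n.+1%:R => n0; field; rewrite gt_eqF.
rewrite [leRHS]splitr lerD2l.
have X0 : 0 <= c * (b - a) ^+ 2 / n.+1%:R.
  by rewrite divr_ge0 ?(ltW n0) // mulr_ge0 ?sqr_ge0.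
have X1 : c * (b - a) ^+ 2 / n.+1%:R <= e / 2.
  by rewrite ler_pdivrMr // [leRHS]mulrC ltW.
have : u * (1 - u) <= 1 by case/andP: u01 => u0 u1; nra.
have : 0 <= u * (1 - u) by case/andP: u01 => u0 u1; nra.
move: X0 X1; set X := c * _ / _; set v := u * _; nra.
Qed.

Lemma cont_on_inv a b c : ~~ (a <= c <= b) -> cont_on a b (fun t => (t - c)^-1).
Proof.
move=> cab x xab e e0.
have xc : x - c != 0 by apply: contraNneq cab => /eqP; rewrite subr_eq0 => /eqP <-.
have : {for x, continuous (fun t : R => (t - c)^-1)}.
  apply: continuousV => //; apply: continuousB; [exact: cvg_id|exact: cvg_cst].
move=> /cvgrPdist_le /(_ e e0) [r /= r0 Hr].
by exists r => // y _ xy; apply: Hr.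
Qed.

Lemma cont_on_powR a b alpha : 0 < a \/ (a = 0 /\ 0 <= alpha) ->
  cont_on a b (fun t => t `^ alpha).
Proof.
move=> aok x /andP[ax xb] e e0.
have a0 : 0 <= a by case: aok => [/ltW|[->]].
have [x0|x0] := ltP 0 x.
  have : {for x, continuous (fun t : R => t `^ alpha)}.
    apply: differentiable_continuous; apply/derivable1_diffP.
    by apply: derivable_powR; rewrite in_itv/= x0.
  move=> /cvgrPdist_le /(_ e e0) [r /= r0 Hr].
  by exists r => // y _ xy; apply: Hr.
have {x0} x0 : x = 0 by lra.
case: aok => [|[a00 al0]]; first lra.
rewrite {x}x0 in ax xb *.
move: al0; rewrite le_eqVlt => /orP[/eqP <-|al0].
  by exists 1 => // y _ _; rewrite !powRr0 subrr normr0 ltW.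
exists (e `^ alpha^-1); first exact: powR_gt0.
move=> y; rewrite a00 => /andP[y0 _]; rewrite sub0r normrN ger0_norm // => ye.
rewrite powR0 ?gt_eqF // sub0r normrN ger0_norm ?powR_ge0 //.
have -> : e = (e `^ alpha^-1) `^ alpha.
  by rewrite -powRrM mulVf ?gt_eqF // powRr1 // ltW.
by apply: ge0_ler_powR; rewrite ?nnegrE ?powR_ge0 // ltW.
Qed.

End Weierstrass.

(** * Moduli of complex numbers and finite sums of squares *)

Section Modulus.
Variable R : realType.
Notation C := (Cplx R).
Implicit Types z : C.

Lemma absC_sqr z : absC z ^+ 2 = complex.Re z ^+ 2 + complex.Im z ^+ 2.
Proof.
by rewrite absC_normc; case: z => a b /=; rewrite sqr_sqrtr // addr_ge0 ?sqr_ge0.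
Qed.

Lemma normC_absC z : `|z| = ofR (absC z).
Proof. by []. Qed.

Lemma absC_ofR (a : R) : absC (ofR a) = `|a|.
Proof. by rewrite absC_normc /= expr0n addr0 sqrtr_sqr. Qed.

Lemma absC1 : absC (1 : C) = 1.
Proof. by rewrite absC_normc ComplexField.Normc.normc1. Qed.

Lemma absCN z : absC (- z) = absC z.
Proof. by rewrite !absC_normc normcN. Qed.

Lemma absC_dist z1 z2 : absC (z1 - z2) = absC (z2 - z1).
Proof. by rewrite -absCN opprB. Qed.

Lemma absC_eq0 z : absC z = 0 -> z = 0.
Proof. by rewrite absC_normc => /ComplexField.Normc.eq0_normc. Qed.

Lemma ge_Re_absC z : `|complex.Re z| <= absC z.
Proof.
rewrite -(@ler_pXn2r _ 2) ?nnegrE ?absC_ge0 // real_normK ?num_real // absC_sqr.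
by rewrite lerDl sqr_ge0.
Qed.

Lemma ge_Im_absC z : `|complex.Im z| <= absC z.
Proof.
rewrite -(@ler_pXn2r _ 2) ?nnegrE ?absC_ge0 // real_normK ?num_real // absC_sqr.
by rewrite lerDr sqr_ge0.
Qed.

Lemma absC_le_ReIm z : absC z <= `|complex.Re z| + `|complex.Im z|.
Proof.
rewrite -(@ler_pXn2r _ 2) ?nnegrE ?absC_ge0 ?addr_ge0 // absC_sqr.
rewrite -(real_normK (num_real (complex.Re z))) -(real_normK (num_real (complex.Im z))).
have := mulr_ge0 (normr_ge0 (complex.Re z)) (normr_ge0 (complex.Im z)).
by rewrite sqrrD -mulr_natl; lra.
Qed.

End Modulus.

Section FiniteSums.
Variable R : realType.

Lemma ler_sum_uniq (I : eqType) (s1 s2 : seq I) (g : I -> R) :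
    uniq s1 -> uniq s2 -> (forall i, 0 <= g i) ->
    (forall i, i \in s1 -> g i != 0 -> i \in s2) ->
  \sum_(i <- s1) g i <= \sum_(i <- s2) g i.
Proof.
move=> u1 u2 g0 sub.
rewrite (bigID (fun i => i \in s2)) /= [X in _ + X]big_seq_cond.
rewrite [X in _ + X]big1 ?addr0; last first.
  move=> i /andP[i1 i2]; apply/eqP; apply: contraNT i2; exact: sub.
rewrite [leRHS](bigID (fun i => i \in s1)) /= -!(big_filter _ (fun i => i \in _)).
rewrite (perm_big [seq i <- s2 | i \in s1]).
  by rewrite lerDl sumr_ge0.
by apply: uniq_perm; rewrite ?filter_uniq // => i; rewrite !mem_filter andbC.
Qed.

(** For positive A and B, summing
    (f + g)^2 <= (1 + B / A) f^2 + (1 + A / B) g^2 gives (A + B)^2 exactly; the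
    degenerate cases follow by enlarging A and B by a small t. *)
Lemma minkowski_sum (I : Type) (s : seq I) (f g : I -> R) (A B : R) :
    0 <= A -> 0 <= B ->
    \sum_(i <- s) f i ^+ 2 <= A ^+ 2 -> \sum_(i <- s) g i ^+ 2 <= B ^+ 2 ->
  \sum_(i <- s) (f i + g i) ^+ 2 <= (A + B) ^+ 2.
Proof.
have pos (A' B' : R) : 0 < A' -> 0 < B' ->
    \sum_(i <- s) f i ^+ 2 <= A' ^+ 2 -> \sum_(i <- s) g i ^+ 2 <= B' ^+ 2 ->
  \sum_(i <- s) (f i + g i) ^+ 2 <= (A' + B') ^+ 2.
  move=> A0 B0 fA gB.
  apply: (@le_trans _ _ (\sum_(i <- s) ((1 + B' / A') * f i ^+ 2 + (1 + A' / B') * g i ^+ 2))).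
    apply: ler_sum => i _; rewrite -subr_ge0.
    have -> : (1 + B' / A') * f i ^+ 2 + (1 + A' / B') * g i ^+ 2 - (f i + g i) ^+ 2 =
        (A' * B')^-1 * (B' * f i - A' * g i) ^+ 2 by field; rewrite !gt_eqF.
    by rewrite mulr_ge0 ?sqr_ge0 // invr_ge0 ltW ?mulr_gt0.
  rewrite big_split /= -!mulr_sumr.
  have -> : (A' + B') ^+ 2 = (1 + B' / A') * A' ^+ 2 + (1 + A' / B') * B' ^+ 2.
    by field; rewrite !gt_eqF.
  by apply: lerD; apply: ler_wpM2l => //; rewrite addr_ge0 // divr_ge0 // ltW.
move=> A0 B0 fA gB; apply/ler_addgt0Pr => e e0.
set D := A + B; have D0 : 0 <= D by rewrite addr_ge0.
(* (D + 2 t)^2 <= D^2 + t (4 D + 4) for t <= 1. *)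
pose t := Num.min 1 (e / (4 * D + 4)).
have t0 : 0 < t by rewrite lt_min ltr01 divr_gt0 //; lra.
have t1 : t <= 1 by rewrite ge_min lexx.
have te : t * (4 * D + 4) <= e.
  by rewrite -ler_pdivlMr ?ge_min ?lexx ?orbT //; lra.
apply: (@le_trans _ _ ((A + t + (B + t)) ^+ 2)).
  apply: pos; [lra|lra| |].
  - by apply: (le_trans fA); rewrite lerXn2r ?nnegrE ?addr_ge0 ?lerDl // ltW.
  - by apply: (le_trans gB); rewrite lerXn2r ?nnegrE ?addr_ge0 ?lerDl // ltW.
rewrite (_ : A + t + (B + t) = D + 2 * t); last by rewrite /D; ring.
nra.
Qed.

Definition int_range (P Q : nat) : seq int := [seq i%:Z - P%:Z | i <- iota 0 (P + Q).+1].

Lemma int_range_uniq P Q : uniq (int_range P Q).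
Proof. by rewrite map_inj_uniq ?iota_uniq // => i j; lia. Qed.

Lemma mem_int_range P Q (m : int) : (m \in int_range P Q) = (- P%:Z <= m <= Q%:Z).
Proof.
apply/mapP/idP => [ [i + ->] |mPQ]; first by rewrite mem_iota; lia.
by exists (absz (m + P%:Z)); rewrite ?mem_iota; lia.
Qed.

Lemma big_int_range (V : nmodType) P Q (F : int -> V) :
  \sum_(m <- int_range P Q) F m = \sum_(i < (P + Q).+1) F (i%:Z - P%:Z).
Proof. by rewrite big_map -{1}(subn0 (P + Q).+1) -/(index_iota _ _) big_mkord. Qed.

Lemma int_range_cover (s : seq int) : exists N : nat, {subset s <= int_range N N}.
Proof.
exists (\sum_(m <- s) absz m)%N => m ms; rewrite mem_int_range.
have : (absz m <= \sum_(m <- s) absz m)%N by rewrite (big_rem m) //= leq_addr.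
lia.
Qed.

End FiniteSums.

(** * The norm of square-summable sequences *)

Section Ell2Norm.
Variable R : realType.
Notation C := (Cplx R).
Notation H := (ell2 R).
Implicit Types (x y : H) (a : C).

Lemma ell2_eqP x y : (forall m, x m = y m) -> x = y.
Proof. by move=> xy; apply: val_inj; apply/funext. Qed.

Lemma ell2D x y m : (x + y) m = x m + y m.
Proof. by []. Qed.

Lemma ell2N x m : (- x) m = - x m.
Proof. by []. Qed.

Lemma ell2B x y m : (x - y) m = x m - y m.
Proof. by []. Qed.

Lemma ell2Z a x m : (a *: x) m = a * x m.
Proof. by []. Qed.

Definition ell2E := (ell2D, ell2N, ell2Z).

Lemma ell20 m : (0 : H) m = 0.
Proof. by []. Qed.

Lemma ell2_sum (I : Type) (r : seq I) (P : pred I) (F : I -> H) m :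
  (\sum_(i <- r | P i) F i) m = \sum_(i <- r | P i) F i m.
Proof. by apply: (big_morph (fun x : H => x m)). Qed.

Lemma sqsum_seq (f : int -> C) (s : seq int) : uniq s ->
  ((\sum_(m <- s) absC (f m) ^+ 2)%:E <= sqsum f)%E.
Proof.
move=> us; apply: ereal_sup_ubound; exists [set` s] => /=.
  by split => //; exact: finite_seq.
by rewrite -fsbig_seq // sumEFin.
Qed.

(** Symmetric intervals are cofinal among finite sets of integers. *)
Lemma sqsum_le (f : int -> C) (c : R) :
    (forall N, \sum_(m <- int_range N N) absC (f m) ^+ 2 <= c) ->
  (sqsum f <= c%:E)%E.
Proof.
move=> fc; apply: ge_ereal_sup => _ [A [finA _] <-].
rewrite fsbig_finite //= sumEFin lee_fin.
have [N sN] := int_range_cover (finmap.enum_fset (fset_set A)).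
apply: (le_trans _ (fc N)); apply: ler_sum_uniq.
- exact: finmap.fset_uniq.
- exact: int_range_uniq.
- by move=> i; rewrite sqr_ge0.
- by move=> i iA _; exact: sN.
Qed.

Lemma sqsum_fin x : sqsum x = (ell2_norm x ^+ 2)%:E.
Proof.
have x0 : (0 <= sqsum x)%E by apply: esum_ge0 => m _; rewrite lee_fin sqr_ge0.
case: x x0 => f /= f2 x0; rewrite /ell2_norm /= sqr_sqrtr ?fine_ge0 //.
by rewrite fineK // ge0_fin_numE //; apply/asboolP.
Qed.

Lemma ell2_norm_ge0 x : 0 <= ell2_norm x.
Proof. exact: sqrtr_ge0. Qed.

Lemma ell2_norm_seq x (s : seq int) : uniq s ->
  \sum_(m <- s) absC (x m) ^+ 2 <= ell2_norm x ^+ 2.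
Proof. by move=> us; rewrite -lee_fin -sqsum_fin; exact: sqsum_seq. Qed.

Lemma ell2_norm_le x (c : R) : 0 <= c ->
    (forall N, \sum_(m <- int_range N N) absC (x m) ^+ 2 <= c ^+ 2) ->
  ell2_norm x <= c.
Proof.
move=> c0 xc; rewrite -(@ler_pXn2r _ 2) ?nnegrE ?ell2_norm_ge0 //.
by rewrite -lee_fin -sqsum_fin; exact: sqsum_le.
Qed.

Lemma ell2_coord x m : absC (x m) <= ell2_norm x.
Proof.
rewrite -(@ler_pXn2r _ 2) ?nnegrE ?absC_ge0 ?ell2_norm_ge0 //.
by have := @ell2_norm_seq x [:: m] isT; rewrite big_seq1.
Qed.

Lemma ell2_norm_eq0 x : ell2_norm x = 0 -> x = 0.
Proof.
move=> x0; apply: ell2_eqP => m; apply: absC_eq0; apply/eqP.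
by rewrite eq_le absC_ge0 -{1}x0 ell2_coord.
Qed.

Lemma ell2_norm0 : ell2_norm (0 : H) = 0.
Proof.
apply/eqP; rewrite eq_le ell2_norm_ge0 andbT; apply: ell2_norm_le => // N.
by rewrite big1 ?expr0n // => m _; rewrite ell20 absC0 expr0n.
Qed.

Lemma ell2_normD x y : ell2_norm (x + y) <= ell2_norm x + ell2_norm y.
Proof.
apply: ell2_norm_le => [|N]; first by rewrite addr_ge0 ?ell2_norm_ge0.
apply: (@le_trans _ _ (\sum_(m <- int_range N N) (absC (x m) + absC (y m)) ^+ 2)).
  apply: ler_sum => m _; rewrite ell2D lerXn2r ?nnegrE ?addr_ge0 ?absC_ge0 //.
  exact: absCD.
by apply: minkowski_sum; rewrite ?ell2_norm_ge0 ?ell2_norm_seq ?int_range_uniq.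
Qed.

Lemma ell2_normZ_le a x : ell2_norm (a *: x) <= absC a * ell2_norm x.
Proof.
apply: ell2_norm_le => [|N]; first by rewrite mulr_ge0 ?absC_ge0 ?ell2_norm_ge0.
under eq_bigr do rewrite ell2Z absCM exprMn.
rewrite -mulr_sumr exprMn ler_wpM2l ?sqr_ge0 //.
by rewrite ell2_norm_seq ?int_range_uniq.
Qed.

Lemma ell2_normN x : ell2_norm (- x) = ell2_norm x.
Proof.
by rewrite /ell2_norm /sqsum; under eq_esum do rewrite ell2N absCN.
Qed.

Lemma ell2_distD y x z : ell2_norm (x - z) <= ell2_norm (x - y) + ell2_norm (y - z).
Proof. by rewrite (le_trans _ (ell2_normD _ _)) // addrA subrK. Qed.

Lemma ell2_in_pred (f : int -> C) (c : R) :
    (forall N, \sum_(m <- int_range N N) absC (f m) ^+ 2 <= c) ->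
  f \in @ell2_pred R.
Proof. by move=> fc; apply/asboolP; rewrite (le_lt_trans (sqsum_le fc)) // ltry. Qed.

Definition supported_in (P Q : nat) x := forall m, ~~ (- P%:Z <= m <= Q%:Z) -> x m = 0.

Lemma supported_in_norm P Q x : supported_in P Q x ->
  ell2_norm x ^+ 2 = \sum_(m <- int_range P Q) absC (x m) ^+ 2.
Proof.
move=> sx; apply/eqP; rewrite eq_le ell2_norm_seq ?int_range_uniq // andbT.
rewrite -lee_fin -sqsum_fin; apply: sqsum_le => N.
apply: ler_sum_uniq; rewrite ?int_range_uniq //.
- by move=> i; rewrite sqr_ge0.
- move=> i _; apply: contraNT; rewrite mem_int_range => /sx ->.
  by rewrite absC0 expr0n.
Qed.

Lemma supported_in_weaken P Q P' Q' x : (P <= P')%N -> (Q <= Q')%N ->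
  supported_in P Q x -> supported_in P' Q' x.
Proof. by move=> PP QQ sx m mPQ; apply: sx; lia. Qed.

Lemma supported_inD P Q x y :
  supported_in P Q x -> supported_in P Q y -> supported_in P Q (x + y).
Proof. by move=> sx sy m mPQ; rewrite ell2D sx // sy // addr0. Qed.

Lemma supported_inZ P Q a x : supported_in P Q x -> supported_in P Q (a *: x).
Proof. by move=> sx m mPQ; rewrite ell2Z sx // mulr0. Qed.

Lemma supported_in_sum P Q (I : Type) (r : seq I) (A : pred I) (F : I -> H) :
  (forall i, A i -> supported_in P Q (F i)) -> supported_in P Q (\sum_(i <- r | A i) F i).
Proof.
move=> FA; elim/big_ind: _ => //; first exact: supported_inD.
Qed.

Lemma ell2_basisE n m : ell2_basis R n m = (m == n)%:R.
Proof. by []. Qed.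

Lemma supported_in_basis P Q n : - P%:Z <= n <= Q%:Z -> supported_in P Q (ell2_basis R n).
Proof. by move=> nPQ m mPQ; rewrite ell2_basisE; case: eqP => // mn; lia. Qed.

Lemma supported_in_decomp P Q x : supported_in P Q x ->
  x = \sum_(n <- int_range P Q) x n *: ell2_basis R n.
Proof.
move=> sx; apply: ell2_eqP => m; rewrite ell2_sum.
under eq_bigr do rewrite ell2Z ell2_basisE.
have [mPQ|mPQ] := boolP (m \in int_range P Q).
  rewrite (bigD1_seq m) ?int_range_uniq //= eqxx mulr1 big1 ?addr0 // => n nm.
  by rewrite eq_sym (negbTE nm) mulr0.
rewrite sx -?mem_int_range // big_seq big1 // => n nPQ.
by rewrite (_ : m == n = false) ?mulr0 //; apply: contraNF mPQ => /eqP ->.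
Qed.

Lemma ell2_norm_basis n : ell2_norm (ell2_basis R n) <= 1.
Proof.
apply: ell2_norm_le => // N; rewrite expr1n.
apply: (@le_trans _ _ (\sum_(m <- [:: n]) absC (ell2_basis R n m) ^+ 2)).
  apply: ler_sum_uniq; rewrite ?int_range_uniq //.
  - by move=> i; rewrite sqr_ge0.
  - move=> i _; have [->|/negbTE ni] := eqVneq i n; first by rewrite inE.
    by rewrite ell2_basisE ni absC0 expr0n eqxx.
by rewrite big_seq1 ell2_basisE eqxx absC1 expr1n.
Qed.

Definition truncate N x : H := \sum_(n <- int_range N N) x n *: ell2_basis R n.

Lemma supported_in_truncate N x : supported_in N N (truncate N x).
Proof.
rewrite /truncate big_seq; apply: supported_in_sum => n; rewrite mem_int_range => nN.
by apply: supported_inZ; exact: supported_in_basis.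
Qed.

Lemma truncateE N x m : truncate N x m = if m \in int_range N N then x m else 0.
Proof.
rewrite ell2_sum; under eq_bigr do rewrite ell2Z ell2_basisE.
case: ifP => mN.
  rewrite (bigD1_seq m) ?int_range_uniq //= eqxx mulr1 big1 ?addr0 // => n nm.
  by rewrite eq_sym (negbTE nm) mulr0.
rewrite big_seq big1 // => n nN.
by rewrite (_ : m == n = false) ?mulr0 //; apply: contraFF mN => /eqP ->.
Qed.

Lemma truncate_norm N x : ell2_norm (truncate N x) <= ell2_norm x.
Proof.
apply: ell2_norm_le => [|K]; first exact: ell2_norm_ge0.
apply: (le_trans _ (ell2_norm_seq x (int_range_uniq K K))).
apply: ler_sum => m _; rewrite truncateE; case: ifP => // _.
by rewrite absC0 expr0n /= sqr_ge0.
Qed.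

(** The squared norm is the supremum of the sums over intervals, and what an
    interval misses is the squared norm of the rest. *)
Lemma truncate_approx x (e : R) : 0 < e ->
  exists N, ell2_norm (x - truncate N x) <= e.
Proof.
move=> e0.
have [N HN] : exists N,
    ell2_norm x ^+ 2 - e ^+ 2 < \sum_(m <- int_range N N) absC (x m) ^+ 2.
  apply: contrapT => /forallNP HN.
  have : ell2_norm x ^+ 2 <= ell2_norm x ^+ 2 - e ^+ 2.
    rewrite -lee_fin -sqsum_fin; apply: sqsum_le => N.
    by rewrite leNgt; apply/negP/HN.
  have := exprn_gt0 2 e0; lra.
exists N; apply: ell2_norm_le => [|K]; first exact: ltW.
have H : \sum_(m <- int_range K K) absC ((x - truncate N x) m) ^+ 2 +
    \sum_(m <- int_range N N) absC (x m) ^+ 2 <= ell2_norm x ^+ 2; last lra.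
pose M := maxn K N.
apply: le_trans (ell2_norm_seq x (int_range_uniq M M)).
have -> : \sum_(m <- int_range M M) absC (x m) ^+ 2 =
    \sum_(m <- int_range M M) absC ((x - truncate N x) m) ^+ 2 +
    \sum_(m <- int_range M M) absC (truncate N x m) ^+ 2.
  have split_sqr m : absC (x m) ^+ 2 =
      absC ((x - truncate N x) m) ^+ 2 + absC (truncate N x m) ^+ 2.
    rewrite ell2B truncateE; case: ifP => _.
      by rewrite subrr absC0 expr0n add0r.
    by rewrite subr0 absC0 expr0n addr0.
  by rewrite -big_split; apply: eq_bigr => m _; exact: split_sqr.
apply: lerD.
  apply: ler_sum_uniq => [||i|i]; rewrite ?int_range_uniq ?sqr_ge0 //.
  by rewrite !mem_int_range /M; lia.
have -> : \sum_(m <- int_range N N) absC (x m) ^+ 2 =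
    \sum_(m <- int_range N N) absC (truncate N x m) ^+ 2.
  by rewrite !big_seq; apply: eq_bigr => m mN; rewrite truncateE mN.
apply: ler_sum_uniq => [||i|i]; rewrite ?int_range_uniq ?sqr_ge0 //.
by rewrite !mem_int_range /M; lia.
Qed.

End Ell2Norm.

Section Completeness.
Variable R : realType.
Notation C := (Cplx R).
Notation H := (ell2 R).

(** The limit is the supremum of the lower bounds u_n - e_n. *)
Lemma real_cauchy_rate (u e : nat -> R) : (forall n, 0 <= e n) ->
    (forall n k, (n <= k)%N -> `|u n - u k| <= e n) ->
  exists l, forall n, `|u n - l| <= e n.
Proof.
move=> e0 ue; pose A := [set u n - e n | n in setT].
have ub k : ubound A (u k + e k).
  move=> _ [n _ <-]; have [nk|/ltnW kn] := leqP n k.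
    have := ue _ _ nk; have := e0 k; rewrite ler_norml; lra.
  have := ue _ _ kn; have := e0 n; rewrite ler_norml; lra.
have supA : has_sup A by split; [exists (u 0%N - e 0%N); exists 0%N | exists (u 0%N + e 0%N)].
exists (sup A) => n; rewrite ler_norml.
have : u n - e n <= sup A by apply: ub_le_sup; [case: supA | exists n].
have : sup A <= u n + e n by apply: ge_sup => //; case: supA.
lra.
Qed.

Lemma rate_small (c w : R) (n : nat) : 0 <= c -> 0 < w ->
  exists2 k, (n <= k)%N & c / k.+1%:R <= w.
Proof.
move=> c0 w0; have := archi_boundP (divr_ge0 c0 (ltW w0)); set k := Num.bound _ => Hk.
exists (maxn n k); first exact: leq_maxl.
rewrite ler_pdivrMr ?ltr0n // mulrC -ler_pdivrMr // (le_trans (ltW Hk)) // ler_nat.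
by rewrite ltnW // ltnS leq_maxr.
Qed.

(** Completeness. Coordinates converge to some f; on a finite set of indices
    u_n - f is compared with u_n - u_k, whose norm is controlled, for a k so
    large that u_k and f nearly agree there. *)
Lemma ell2_cauchy_rate (u : nat -> H) (c : R) : 0 <= c ->
    (forall n k, (n <= k)%N -> ell2_norm (u n - u k) <= c / n.+1%:R) ->
  exists y, forall n, ell2_norm (u n - y) <= c / n.+1%:R.
Proof.
move=> c0 uc; pose e n := c / n.+1%:R.
have e0 n : 0 <= e n by rewrite divr_ge0.
have lim m : exists z : C, forall n, absC (u n m - z) <= 2 * e n.
  have uce n k : (n <= k)%N -> absC (u n m - u k m) <= e n.
    by move=> nk; apply: le_trans (ell2_coord (u n - u k) m) (uc _ _ nk).
  have ReB (z1 z2 : C) : complex.Re (z1 - z2) = complex.Re z1 - complex.Re z2.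
    by case: z1 z2 => [? ?] [].
  have ImB (z1 z2 : C) : complex.Im (z1 - z2) = complex.Im z1 - complex.Im z2.
    by case: z1 z2 => [? ?] [].
  have [lr Hr] : exists l, forall n, `|complex.Re (u n m) - l| <= e n.
    apply: real_cauchy_rate => // n k nk; rewrite -ReB.
    exact: le_trans (ge_Re_absC _) (uce _ _ nk).
  have [li Hi] : exists l, forall n, `|complex.Im (u n m) - l| <= e n.
    apply: real_cauchy_rate => // n k nk; rewrite -ImB.
    exact: le_trans (ge_Im_absC _) (uce _ _ nk).
  exists (Complex lr li : C) => n; apply: (le_trans (absC_le_ReIm _)).
  by rewrite ReB ImB mulr_natl mulr2n lerD.
have {lim} [f Hf] := choice lim.
have sum_le n (s : seq int) : uniq s ->
    \sum_(m <- s) absC (u n m - f m) ^+ 2 <= e n ^+ 2.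
  move=> us; apply/ler_addgt0Pr => d d0.
  pose L : R := (size s)%:R + 1.
  have L0 : 1 <= L by rewrite lerDr.
  (* k so large that replacing u_k by f on s costs at most d *)
  have [k nk kd] : exists2 k, (n <= k)%N &
      2 * e n * (2 * e k * L) + (2 * e k * L) ^+ 2 <= d.
    pose w := Num.min 1 (d / (2 * e n + 1)).
    have en1 : 0 < 2 * e n + 1 by have := e0 n; lra.
    have w0 : 0 < w by rewrite lt_min ltr01 divr_gt0.
    have w1 : w <= 1 by rewrite ge_min lexx.
    have wd : w * (2 * e n + 1) <= d by rewrite -ler_pdivlMr // ge_min lexx orbT.
    have [k nk ek] := @rate_small c (w / (2 * L)) n c0 ltac:(by rewrite divr_gt0 //; lra).
    exists k => //; move: ek; rewrite -/(e k) ler_pdivlMr; last lra.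
    have := e0 k; have := e0 n; set t := 2 * e k * L.
    have -> : e k * (2 * L) = t by rewrite /t; ring.
    have t0 : 0 <= t by rewrite /t !mulr_ge0 //; lra.
    nra.
  apply: (@le_trans _ _ ((e n + 2 * e k * L) ^+ 2)).
    apply: (@le_trans _ _ (\sum_(m <- s) (absC ((u n - u k) m) + absC (u k m - f m)) ^+ 2)).
      apply: ler_sum => m _; rewrite lerXn2r ?nnegrE ?addr_ge0 ?absC_ge0 //.
      by rewrite (le_trans _ (absCD _ _)) // ell2B addrA subrK.
    apply: minkowski_sum => //.
    - by rewrite !mulr_ge0 // (le_trans _ L0).
    - apply: (le_trans (ell2_norm_seq _ us)).
      by rewrite lerXn2r ?nnegrE ?ell2_norm_ge0 // uc.
    apply: (@le_trans _ _ (\sum_(m <- s) (2 * e k) ^+ 2)).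
      apply: ler_sum => m _; rewrite lerXn2r ?nnegrE ?absC_ge0 // mulr_ge0 //.
    rewrite big_const_seq count_predT iter_addr_0 -[_ *+ size s]mulr_natr [leRHS]exprMn.
    rewrite ler_wpM2l ?sqr_ge0 // /L.
    have : (0 : R) <= (size s)%:R by []. nra.
  by move: kd; set t := 2 * e k * L; nra.
pose M := e 0%N + ell2_norm (u 0%N).
have f2 : f \in @ell2_pred R.
  apply: (@ell2_in_pred _ _ (M ^+ 2)) => N.
  apply: (@le_trans _ _
    (\sum_(m <- int_range N N) (absC (u 0%N m - f m) + absC (u 0%N m)) ^+ 2)).
    apply: ler_sum => m _; rewrite lerXn2r ?nnegrE ?addr_ge0 ?absC_ge0 //.
    by rewrite -absCN -(absC_dist (f m)) (le_trans _ (absCD _ _)) // subrK absCN.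
  apply: minkowski_sum; rewrite ?ell2_norm_ge0 ?ell2_norm_seq ?int_range_uniq //.
  by apply: sum_le; exact: int_range_uniq.
exists (Ell2 f2) => n; apply: ell2_norm_le => [|N]; first exact: e0.
by apply: sum_le; exact: int_range_uniq.
Qed.

End Completeness.

(** * Bounded operators and polynomials of an operator *)

Section Operators.
Variable R : realType.
Notation C := (Cplx R).
Notation H := (ell2 R).
Implicit Types (x y : H) (a : C) (T S : H -> H) (c : R).

Definition bounded_by T c := forall x, ell2_norm (T x) <= c * ell2_norm x.

Lemma opnorm_le T c : 0 <= c -> bounded_by T c -> (opnorm T <= c%:E)%E.
Proof.
move=> c0 Tc; apply: ge_ereal_sup => _ [x /= x1 <-]; rewrite lee_fin.
by rewrite (le_trans (Tc x)) // ler_piMr.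
Qed.

Lemma linearT0 T : linear T -> T 0 = 0.
Proof.
move=> linT; have := linT (-1) 0 0; rewrite scaler0 addr0 scaleN1r => {1}->.
by rewrite addNr.
Qed.

Lemma linearTZ T a x : linear T -> T (a *: x) = a *: T x.
Proof. by move=> linT; have := linT a x 0; rewrite (linearT0 linT) !addr0. Qed.

Lemma linearTD T x y : linear T -> T (x + y) = T x + T y.
Proof. by move=> linT; have := linT 1 x y; rewrite !scale1r. Qed.

Lemma opnorm_bounded T c : linear T -> (opnorm T <= c%:E)%E -> bounded_by T c.
Proof.
move=> linT Tc x; have [x0|x0] := eqVneq (ell2_norm x) 0.
  by rewrite (ell2_norm_eq0 x0) linearT0 // ell2_norm0 mulr0.
have xp : 0 < ell2_norm x by rewrite lt_def x0 ell2_norm_ge0.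
pose u := ofR (ell2_norm x)^-1 *: x.
have ofRn : ofR (ell2_norm x) * ofR (ell2_norm x)^-1 = 1.
  by rewrite /ofR -rmorphM mulfV // rmorph1.
have -> : x = ofR (ell2_norm x) *: u by rewrite /u scalerA ofRn scale1r.
have u1 : ell2_norm u <= 1.
  apply: (le_trans (ell2_normZ_le _ _)); rewrite absC_ofR ger0_norm ?mulVf //.
  by rewrite invr_ge0 ltW.
rewrite linearTZ //; apply: (le_trans (ell2_normZ_le _ _)).
rewrite absC_ofR ger0_norm ?ell2_norm_ge0 //.
have -> : ofR (ell2_norm x) *: u = x by rewrite /u scalerA ofRn scale1r.
rewrite mulrC ler_wpM2r ?ell2_norm_ge0 // -lee_fin.
by apply: le_trans Tc; apply: ereal_sup_ubound; exists u.
Qed.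

Lemma opnorm_fin_bounded T : linear T -> (opnorm T < +oo)%E ->
  exists2 c, 0 <= c & bounded_by T c.
Proof.
move=> linT Tfin.
have T0 : (0%:E <= opnorm T)%E.
  apply: ereal_sup_ubound; exists 0 => /=; first by rewrite ell2_norm0.
  by rewrite (linearT0 linT) ell2_norm0.
have Tnum : opnorm T \is a fin_num by rewrite ge0_fin_numE.
exists (fine (opnorm T)); first exact: fine_ge0.
by apply: opnorm_bounded; rewrite ?fineK.
Qed.

Lemma bounded_by_dense T B c : linear T -> bounded_by T B -> 0 <= c ->
    (forall N x, supported_in N N x -> ell2_norm (T x) <= c * ell2_norm x) ->
  bounded_by T c.
Proof.
move=> linT TB c0 Tc x; apply/ler_addgt0Pr => e e0.
have B0 : 0 < `|B| + 1 by rewrite ltr_pwDr.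
have [N HN] := truncate_approx x (divr_gt0 e0 B0).
have -> : T x = T (truncate N x) + T (x - truncate N x).
  by rewrite -linearTD // addrC subrK.
apply: (le_trans (ell2_normD _ _)); apply: lerD.
  apply: le_trans (Tc N _ (@supported_in_truncate R N x)) _.
  by rewrite ler_wpM2l // truncate_norm.
apply: (le_trans (TB _)); apply: (@le_trans _ _ ((`|B| + 1) * ell2_norm (x - truncate N x))).
  rewrite ler_wpM2r ?ell2_norm_ge0 //; have := ler_norm B; lra.
by rewrite mulrC -ler_pdivlMr.
Qed.

End Operators.

Section OpPoly.
Variable R : realType.
Notation C := (Cplx R).
Notation H := (ell2 R).
Variable T : {linear H -> H}.
Implicit Types (x y : H) (a : C) (p q : {poly C}).

(** Complex coefficients are allowed because polynomials are later split into
    linear factors. *)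
Definition opoly p x : H := \sum_(i < size p) p`_i *: iter i T x.

Lemma opoly_widen n p x : (size p <= n)%N ->
  opoly p x = \sum_(i < n) p`_i *: iter i T x.
Proof.
move=> pn; rewrite /opoly (big_ord_widen n (fun i => p`_i *: iter i T x)) //.
rewrite big_mkcond; apply: eq_bigr => i _; case: ltnP => // ip.
by rewrite nth_default // scale0r.
Qed.

Lemma iter_linear i : linear (iter i T).
Proof.
by move=> a x y; elim: i => //= i ->; rewrite linearP.
Qed.

Lemma opoly_linear p : linear (opoly p).
Proof.
move=> a x y; rewrite /opoly scaler_sumr -big_split; apply: eq_bigr => i _ /=.
by rewrite iter_linear scalerDr !scalerA mulrC.
Qed.

Lemma opolyD p q x : opoly (p + q) x = opoly p x + opoly q x.
Proof.
rewrite !(@opoly_widen (maxn (size p) (size q))) ?leq_maxl ?leq_maxr ?size_polyD //.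
by rewrite -big_split; apply: eq_bigr => i _; rewrite coefD scalerDl.
Qed.

Lemma opolyZ a p x : opoly (a *: p) x = a *: opoly p x.
Proof.
rewrite (@opoly_widen (size p)) ?size_scale_leq // scaler_sumr.
by apply: eq_bigr => i _; rewrite coefZ scalerA.
Qed.

Lemma opolyB p q x : opoly (p - q) x = opoly p x - opoly q x.
Proof. by rewrite opolyD -scaleN1r opolyZ scaleN1r. Qed.

Lemma opolyC a x : opoly a%:P x = a *: x.
Proof. by rewrite (@opoly_widen 1) ?size_polyC_leq1 // big_ord1 coefC. Qed.

Lemma opolyMX p x : opoly (p * 'X) x = opoly p (T x).
Proof.
rewrite (@opoly_widen (size p).+1); last first.
  have [->|p0] := eqVneq p 0; first by rewrite mul0r size_poly0.
  by rewrite size_mulX.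
rewrite big_ord_recl coefMX scale0r add0r; apply: eq_bigr => i _.
by rewrite coefMX /= -iterSr.
Qed.

Lemma opolyX x : opoly 'X x = T x.
Proof. by rewrite -['X]mul1r opolyMX opolyC scale1r. Qed.

Lemma opoly_comm p x : T (opoly p x) = opoly p (T x).
Proof.
rewrite linear_sum; apply: eq_bigr => i _.
by rewrite linearZ /= -iterS iterSr.
Qed.

Lemma opolyM p q x : opoly (p * q) x = opoly p (opoly q x).
Proof.
elim/poly_ind: p x => [|p c IH] x.
  by rewrite mul0r /opoly size_poly0 !big_ord0.
rewrite mulrDl -mulrA ['X * q]mulrC mulrA mul_polyC !opolyD opolyZ opolyC !opolyMX.
by rewrite opoly_comm IH.
Qed.

Lemma opoly_XsubC a x : opoly ('X - a%:P) x = T x - a *: x.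
Proof. by rewrite opolyB opolyX opolyC. Qed.

Lemma opoly_bounded p (B : R) : 0 <= B -> bounded_by T B ->
  exists2 c : R, 0 <= c & bounded_by (opoly p) c.
Proof.
move=> B0 TB; exists (\sum_(i < size p) absC p`_i * B ^+ i).
  by apply: sumr_ge0 => i _; rewrite mulr_ge0 ?absC_ge0 // exprn_ge0.
move=> x; rewrite /opoly mulr_suml.
have iterB i : ell2_norm (iter i T x) <= B ^+ i * ell2_norm x.
  elim: i => [|i IH] /=; first by rewrite expr0 mul1r.
  by rewrite (le_trans (TB _)) // exprS -mulrA ler_wpM2l.
elim/big_ind2 : _ => [|x1 c1 x2 c2 H1 H2|i _]; first by rewrite ell2_norm0.
  by rewrite (le_trans (ell2_normD _ _)) // lerD.
by rewrite (le_trans (ell2_normZ_le _ _)) // -mulrA ler_wpM2l ?absC_ge0.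
Qed.

Definition cpoly (p : {poly R}) : {poly C} := map_poly (real_complex R) p.

Lemma polyop_opoly (p : {poly R}) x : polyop p T x = opoly (cpoly p) x.
Proof.
rewrite /polyop /opoly /cpoly size_map_poly.
by apply: eq_bigr => i _; rewrite coef_map.
Qed.

Lemma horner_cpoly (p : {poly R}) (t : R) : (cpoly p).[ofR t] = ofR p.[t].
Proof. by rewrite /cpoly horner_map. Qed.

End OpPoly.

(** * Matrix elements and functions of normal matrices *)

Section MatrixElements.
Variable R : realType.
Notation C := (Cplx R).
Notation H := (ell2 R).

Lemma mxeltE (T : H -> H) m n : mxelt T m n = T (ell2_basis R n) m.
Proof.
rewrite /mxelt /ell2_dot; set x := T _.
apply: lim_near_cst => //.
exists (absz m) => // N /= mN.
rewrite -addnn -(big_int_range _ _ (fun j => x j * (ell2_basis R m j)^*)).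
rewrite (bigD1_seq m) ?int_range_uniq ?mem_int_range //=; last lia.
rewrite /delta eqxx conjC1 mulr1 big1 ?addr0 // => j jm.
by rewrite (negbTE jm) conjC0 mulr0.
Qed.

End MatrixElements.

Section FiniteMatrix.
Variable R : realType.
Notation C := (Cplx R).
Implicit Types (n : nat).
Local Open Scope sesquilinear_scope.

Lemma vec_norm_ge0 n (x : 'cV[C]_n) : 0 <= vec_norm x.
Proof. exact: sqrtr_ge0. Qed.

Lemma vec_norm_sqr n (x : 'cV[C]_n) : vec_norm x ^+ 2 = \sum_(i < n) absC (x i ord0) ^+ 2.
Proof. by rewrite sqr_sqrtr // sumr_ge0 // => i _; rewrite sqr_ge0. Qed.

Lemma absC_sqrC (z : C) : ofR (absC z ^+ 2) = z * z^*.
Proof. by rewrite -normCK normC_absC /ofR rmorphXn. Qed.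

Lemma vec_norm_dot n (x : 'cV[C]_n) : ofR (vec_norm x ^+ 2) = (x ^t* *m x) ord0 ord0.
Proof.
rewrite vec_norm_sqr /ofR rmorph_sum mxE; apply: eq_bigr => i _.
by transitivity (x i ord0 * (x i ord0)^*); [exact: absC_sqrC | rewrite !mxE mulrC].
Qed.

Lemma vec_norm_unitary n (U : 'M[C]_n) (x : 'cV[C]_n) :
  U \is unitarymx -> vec_norm (U *m x) = vec_norm x.
Proof.
move=> Uu; apply/eqP; rewrite -(@eqrXn2 _ 2) ?vec_norm_ge0 //.
apply/eqP; apply: (@complexI R).
rewrite -!/(ofR _) !vec_norm_dot trmx_mul map_mxM mulmxA -[_ *m _ *m U]mulmxA.
by rewrite -(invmx_unitary Uu) mulVmx ?mulmx1 ?unitarymx_unit.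
Qed.

(** In an orthonormal eigenbasis a function of A acts on coordinates. *)
Lemma normal_calculus n (A : 'M[C]_n) (g : 'rV[C]_n) (v : 'cV[C]_n) :
  vec_norm (invmx (spectralmx A) *m diag_mx g *m spectralmx A *m v) ^+ 2 =
  \sum_i absC (g ord0 i) ^+ 2 * absC ((spectralmx A *m v) i ord0) ^+ 2.
Proof.
set U := spectralmx A.
have Uu : U \is unitarymx by exact: spectral_unitarymx.
rewrite -!mulmxA vec_norm_unitary; last first.
  by rewrite invmx_unitary // trmxC_unitary.
rewrite vec_norm_sqr; apply: eq_bigr => i _.
by rewrite mul_diag_mx mxE absCM exprMn.
Qed.

Lemma horner_normalmx n (A : 'M[C]_n.+1) (p : {poly C}) : A \is normalmx ->
  horner_mx A p = invmx (spectralmx A) *m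
    diag_mx (map_mx (horner p) (spectral_diag A)) *m spectralmx A.
Proof.
move=> /orthomx_spectralP {1}->.
by rewrite horner_mx_uconjC ?horner_mx_diag // spectral_unit.
Qed.

Lemma spectral_diag_eigen n (A : 'M[C]_n) i : A \is normalmx ->
  eigenvalue A (spectral_diag A ord0 i).
Proof.
move=> /orthomx_spectralP AE; set U := spectralmx A in AE.
have Uu : U \in unitmx by exact: spectral_unit.
have UA : U *m A = diag_mx (spectral_diag A) *m U.
  by rewrite {1}AE !mulmxA mulmxV // mul1mx.
apply/eigenvalueP; exists (row i U).
  by rewrite -row_mul UA mul_diag_mx; apply/rowP => j; rewrite !mxE.
apply/eqP => ri; have := congr1 (fun M => (row i M)) (mulmxV Uu).
rewrite row_mul ri mul0mx row1 => /rowP/(_ i); rewrite !mxE !eqxx /= => /esym/eqP.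
by rewrite oner_eq0.
Qed.

(** The operator norm is tested on the i-th vector of the eigenbasis. *)
Lemma spectral_diag_norm n (A : 'M[C]_n) i (c : R) : A \is normalmx ->
  (mx_opnorm A <= c%:E)%E -> absC (spectral_diag A ord0 i) <= c.
Proof.
move=> /orthomx_spectralP AE Ac; set U := spectralmx A in AE.
have Uu : U \is unitarymx by exact: spectral_unitarymx.
pose v : 'cV[C]_n := invmx U *m delta_mx i ord0.
have Uv : U *m v = delta_mx i ord0.
  by rewrite /v mulmxA mulmxV ?mul1mx // unitarymx_unit.
have v1 : vec_norm v = 1.
  rewrite -(vec_norm_unitary _ Uu) Uv /vec_norm (bigD1 i) //= big1 => [|j ji].
    by rewrite !mxE !eqxx absC1 expr1n addr0 sqrtr1.
  by rewrite mxE (negbTE ji) absC0 expr0n.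
have Av : vec_norm (A *m v) ^+ 2 = absC (spectral_diag A ord0 i) ^+ 2.
  have := normal_calculus A (spectral_diag A) v; rewrite -/U -AE Uv => ->.
  rewrite (bigD1 i) //= big1 => [|j ji].
    by rewrite !mxE !eqxx absC1 expr1n addr0 mulr1.
  by rewrite mxE (negbTE ji) absC0 expr0n mulr0.
have Avc : vec_norm (A *m v) <= c.
  rewrite -lee_fin; apply: le_trans Ac; apply: ereal_sup_ubound.
  by exists v => //=; rewrite v1.
apply: le_trans Avc.
by rewrite -(@ler_pXn2r _ 2) ?nnegrE ?absC_ge0 ?vec_norm_ge0 // Av.
Qed.

Lemma coord_vec_norm n (x : 'cV[C]_n) i : absC (x i ord0) <= vec_norm x.
Proof.
rewrite -(@ler_pXn2r _ 2) ?nnegrE ?absC_ge0 ?vec_norm_ge0 // vec_norm_sqr.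
by rewrite (bigD1 i) //= lerDl sumr_ge0 // => j _; rewrite sqr_ge0.
Qed.

Lemma normal_entry_bound n (A : 'M[C]_n) (g : 'rV[C]_n) (e : R) i j : 0 <= e ->
    (forall i, absC (g ord0 i) <= e) ->
  absC ((invmx (spectralmx A) *m diag_mx g *m spectralmx A) i j) <= e.
Proof.
move=> e0 ge; set M := _ *m _; pose v : 'cV[C]_n := delta_mx j ord0.
have -> : M i j = (M *m v) i ord0 by rewrite /v -colE [RHS]mxE.
apply: le_trans (coord_vec_norm _ _) _.
rewrite -(@ler_pXn2r _ 2) ?nnegrE ?vec_norm_ge0 // normal_calculus.
have v1 : vec_norm (spectralmx A *m v) ^+ 2 = 1.
  rewrite vec_norm_unitary ?spectral_unitarymx // vec_norm_sqr (bigD1 j) //=.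
  rewrite big1 => [|k kj]; last by rewrite mxE (negbTE kj) absC0 expr0n.
  by rewrite !mxE !eqxx absC1 expr1n addr0.
rewrite -[leRHS]mulr1 -v1 vec_norm_sqr mulr_sumr; apply: ler_sum => k _.
by rewrite ler_wpM2r ?sqr_ge0 // lerXn2r ?nnegrE ?absC_ge0.
Qed.

End FiniteMatrix.

(** * Windows of a sparse Hermitian operator *)

Section Windows.
Variable R : realType.
Notation C := (Cplx R).
Notation H := (ell2 R).
Variables (W : {linear H -> H}) (D : int -> int -> C).
Hypothesis W_herm : hermitianZ (mxelt W).
Hypothesis D_herm : hermitianZ D.
Variable k : nat.
Hypothesis W_sparse : row_sparse k (mxelt W).
Implicit Types (x y : H) (p : {poly C}).

(** Sparsity is assumed for rows; Hermitian symmetry carries it to columns,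
    which is what keeps finite supports finite. *)
Lemma finite_column n : exists K : nat, forall m,
  mxelt W m n != 0 -> - K%:Z <= m <= K%:Z.
Proof.
have /finite_seqP[s sE] : finite_set [set m | mxelt W n m != 0].
  by apply/finite_set_leP; exists k.
have [K sK] := int_range_cover s.
exists K => m Wmn; rewrite -mem_int_range; apply: sK.
have : [set` s] m by rewrite -sE /= W_herm conjC_eq0.
by [].
Qed.

Lemma W_supp_expand P Q x m : supported_in P Q x ->
  W x m = \sum_(n <- int_range P Q) mxelt W m n * x n.
Proof.
move=> sx; rewrite {1}(supported_in_decomp sx) linear_sum ell2_sum.
by apply: eq_bigr => n _; rewrite linearZ ell2Z mxeltE mulrC.
Qed.

Lemma W_supp_grow N : exists2 K, (N <= K)%N &
  forall x, supported_in N N x -> supported_in K K (W x).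
Proof.
have [K_ HK] := choice finite_column.
exists (N + \sum_(n <- int_range N N) K_ n)%N; first exact: leq_addr.
move=> x sx m mK; rewrite (W_supp_expand _ sx) big_seq big1 // => n nN.
have [->|/HK mn] := eqVneq (mxelt W m n) 0; first by rewrite mul0r.
exfalso; move: mK.
have : (K_ n <= \sum_(n <- int_range N N) K_ n)%N by rewrite (big_rem n) //= leq_addr.
lia.
Qed.

Lemma iter_supp_grow d N : exists2 K, (N <= K)%N &
  forall x, supported_in N N x -> forall i, (i <= d)%N -> supported_in K K (iter i W x).
Proof.
elim: d => [|d [K NK IH]].
  by exists N => // x sx i; rewrite leqn0 => /eqP ->.
have [K' leKK' HK'] := W_supp_grow K.
exists K' => [|x sx [|i] ile]; first exact: leq_trans leKK'.
- exact: (supported_in_weaken leKK' leKK' (IH x sx 0%N isT)).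
- exact: HK' (IH x sx i ile).
Qed.

Definition restr P Q x : 'cV[C]_(P + Q).+1 := \col_i x (i%:Z - P%:Z).

Lemma restr_norm P Q x : supported_in P Q x -> vec_norm (restr P Q x) = ell2_norm x.
Proof.
move=> sx; apply/eqP; rewrite -(@eqrXn2 _ 2) ?vec_norm_ge0 ?ell2_norm_ge0 //.
apply/eqP; rewrite vec_norm_sqr (supported_in_norm sx) big_int_range.
by apply: eq_bigr => i _; rewrite mxE.
Qed.

Notation win P Q := (window P Q (mxelt W) D).

(** A window differs from W only in entries that multiply the coordinates of x
    at -P and Q, and these vanish. *)
Lemma restr_W P Q N x : (N < P)%N -> (N < Q)%N -> supported_in N N x ->
  restr P Q (W x) = win P Q *m restr P Q x.
Proof.
move=> NP NQ sx; apply/colP => i; rewrite !mxE.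
rewrite (W_supp_expand _ (supported_in_weaken (ltnW NP) (ltnW NQ) sx)) big_int_range.
apply: eq_bigr => j _; rewrite !mxE.
have [jN|/sx ->] := boolP (- N%:Z <= j%:Z - P%:Z <= N%:Z); last by rewrite !mulr0.
by rewrite /= ifT //; lia.
Qed.

(** Truncation is exact on polynomials: no intermediate vector reaches the
    boundary of the window. *)
Lemma restr_opoly P Q N d x p : (N < P)%N -> (N < Q)%N ->
    (forall i, (i <= d)%N -> supported_in N N (iter i W x)) -> (size p <= d.+1)%N ->
  restr P Q (opoly W p x) = horner_mx (win P Q) p *m restr P Q x.
Proof.
move=> NP NQ sx pd.
have iterE i : (i <= d)%N -> restr P Q (iter i W x) = win P Q ^+ i *m restr P Q x.
  elim: i => [|i IH] id; first by rewrite expr0 mul1mx.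
  have -> : win P Q ^+ i.+1 = win P Q *m win P Q ^+ i by exact: exprS.
  rewrite -mulmxA -(IH (ltnW id)); exact: restr_W NP NQ (sx i (ltnW id)).
rewrite (opoly_widen _ _ pd) -[p in RHS](coefK p).
have -> : \poly_(i < size p) p`_i = \sum_(i < d.+1) p`_i *: 'X^i.
  rewrite poly_def (big_ord_widen d.+1 (fun i => p`_i *: 'X^i)) // big_mkcond.
  apply: eq_bigr => i _; case: ltnP => // ip.
  by rewrite nth_default // scale0r.
have restrE (F : 'I_d.+1 -> H) : restr P Q (\sum_i F i) = \sum_i restr P Q (F i).
  by apply/colP => i; rewrite mxE ell2_sum summxE; apply: eq_bigr => j _; rewrite mxE.
rewrite restrE linear_sum mulmx_suml; apply: eq_bigr => i _.
rewrite linearZ rmorphXn /= horner_mx_X -scalemxAl -iterE -1?ltnS //.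
by apply/colP => j; rewrite !mxE.
Qed.

Lemma opoly_supp N d x p :
    (forall i, (i <= d)%N -> supported_in N N (iter i W x)) -> (size p <= d.+1)%N ->
  supported_in N N (opoly W p x).
Proof.
move=> sx pd; apply: supported_in_sum => i _; apply: supported_inZ; apply: sx.
by rewrite -ltnS (leq_trans _ pd).
Qed.

Lemma window_normal P Q : win P Q \is normalmx.
Proof.
apply: hermitian_normalmx; apply/is_hermitianmxP; rewrite expr0 scale1r.
apply/matrixP => i j; rewrite !mxE /= orbC.
by case: ifP => _; rewrite ?rmorphD /= W_herm // D_herm.
Qed.

Variables (a b : R).
Hypothesis window_spectrum : forall P Q, (0 < P)%N -> (0 < Q)%N ->
  forall i, exists2 t, a <= t <= b & spectral_diag (win P Q) ord0 i = ofR t.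

(** A finite stand-in for the spectral measure of x: a window large enough to
    compute p(W) x for all p of degree at most d has its eigenvalues as nodes
    and the squared coordinates of x in its eigenbasis as weights. All norm
    estimates on polynomials of W are read off this formula. *)
Lemma quadrature N x d : supported_in N N x ->
  exists n (t w : 'I_n -> R), (forall i, a <= t i <= b /\ 0 <= w i) /\
    forall p, (size p <= d.+1)%N ->
      ell2_norm (opoly W p x) ^+ 2 = \sum_i absC p.[ofR (t i)] ^+ 2 * w i.
Proof.
move=> sx; have [K NK HK] := iter_supp_grow d N.
pose P := K.+1.
have {}/choice [t Ht] : forall i, exists t,
    a <= t <= b /\ spectral_diag (win P P) ord0 i = ofR t.
  by move=> i; have [t] := window_spectrum (ltn0Sn K) (ltn0Sn K) i; exists t.
exists (P + P).+1, t, (fun i => absC ((spectralmx (win P P) *m restr P P x) i ord0) ^+ 2).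
split=> [i|p pd]; first by split; [case: (Ht i) | rewrite sqr_ge0].
have sK := opoly_supp (HK x sx) pd.
rewrite -(restr_norm (supported_in_weaken (leqnSn K) (leqnSn K) sK)).
rewrite (restr_opoly (ltnSn K) (ltnSn K) (HK x sx) pd).
rewrite horner_normalmx ?window_normal // normal_calculus.
by apply: eq_bigr => i _; rewrite mxE; case: (Ht i) => _ ->.
Qed.

End Windows.

(** * Continuous functions of the operator and its spectrum *)

Section Calculus.
Variable R : realType.
Notation C := (Cplx R).
Notation H := (ell2 R).
Variables (W : {linear H -> H}) (a b : R).
Hypothesis W_bounded : (opnorm W < +oo)%E.
Hypothesis ab : a < b.
(* The windows enter only through the next two properties, supplied by
   [opoly_supp] and [quadrature]. *)
Hypothesis W_finite : forall N x (p : {poly C}), supported_in N N x ->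
  exists K, supported_in K K (opoly W p x).
Hypothesis W_quadrature : forall N x d, supported_in N N x ->
  exists n (t w : 'I_n -> R), (forall i, a <= t i <= b /\ 0 <= w i) /\
    forall p : {poly C}, (size p <= d.+1)%N ->
      ell2_norm (opoly W p x) ^+ 2 = \sum_i absC p.[ofR (t i)] ^+ 2 * w i.
Implicit Types (x y : H) (p q : {poly C}) (r : {poly R}) (f g : R -> R).

Lemma W_linear : linear W.
Proof. by move=> c x y; rewrite linearP. Qed.

Lemma poly_bounded p : exists2 c : R, 0 <= c & bounded_by (opoly W p) c.
Proof.
have [B B0 HB] := opnorm_fin_bounded W_linear W_bounded.
exact: opoly_bounded HB.
Qed.

Lemma quadrature_mass x d n (t w : 'I_n -> R) :
    (forall p, (size p <= d.+1)%N ->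
      ell2_norm (opoly W p x) ^+ 2 = \sum_i absC p.[ofR (t i)] ^+ 2 * w i) ->
  ell2_norm x ^+ 2 = \sum_i w i.
Proof.
move=> /(_ 1%:P); rewrite opolyC scale1r => ->; last first.
  by rewrite (leq_trans (size_polyC_leq1 _)).
by apply: eq_bigr => i _; rewrite hornerC absC1 expr1n mul1r.
Qed.

(** The quadrature formula for p is compared with that for the constant 1, and
    density removes the restriction to finite supports. *)
Lemma poly_norm_le p (s : R) : 0 <= s ->
    (forall t, a <= t <= b -> absC p.[ofR t] <= s) ->
  bounded_by (opoly W p) s.
Proof.
move=> s0 ps; have [c _ pc] := poly_bounded p.
apply: (bounded_by_dense (opoly_linear W p) pc s0) => N x sx.
have [n [t [w [tw E]]]] := W_quadrature (size p) sx.
rewrite -(@ler_pXn2r _ 2) ?nnegrE ?mulr_ge0 ?ell2_norm_ge0 // exprMn.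
rewrite (E p (leqnSn _)) (quadrature_mass E) mulr_sumr; apply: ler_sum => i _.
have [ti wi] := tw i.
rewrite ler_wpM2r // lerXn2r ?nnegrE ?absC_ge0 //.
exact: ps.
Qed.

Lemma cpoly_norm_le r (s : R) : 0 <= s ->
    (forall t, a <= t <= b -> `|r.[t]| <= s) ->
  bounded_by (opoly W (cpoly r)) s.
Proof.
by move=> s0 rs; apply: poly_norm_le => // t tab; rewrite horner_cpoly absC_ofR rs.
Qed.

Lemma rate_le0 (v c : R) : (forall n : nat, v <= c / n.+1%:R) -> v <= 0.
Proof.
move=> vc; rewrite leNgt; apply/negP => v0.
have c0 : 0 <= c by have := vc 0%N; rewrite invr1 mulr1; lra.
have [n _ cn] := @rate_small R c (v / 2) 0%N c0 (divr_gt0 v0 (ltr0n _ 2)).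
have := le_trans (vc n) cn; lra.
Qed.

(** Polynomials converging to g uniformly on [a, b] are Cauchy in operator
    norm by [cpoly_norm_le], and the limit is linear because it is approached
    at a rate uniform on bounded sets. *)
Lemma operator_limit g : cont_on a b g ->
  exists S : H -> H, [/\ linear S, (opnorm S < +oo)%E & forall e : R, 0 < e ->
    exists q : {poly R}, (forall t, a <= t <= b -> `|q.[t] - g t| <= e) /\
      bounded_by (fun x => opoly W (cpoly q) x - S x) e].
Proof.
move=> gc.
have {}/choice [q Hq] : forall n : nat, exists q : {poly R},
    forall t, a <= t <= b -> `|q.[t] - g t| <= n.+1%:R^-1.
  by move=> n; apply: weierstrass => //; rewrite invr_gt0 ltr0n.
pose T n := opoly W (cpoly (q n)).
have Tdist n k : (n <= k)%N -> bounded_by (fun x => T n x - T k x) (2 / n.+1%:R).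
  move=> nk x; rewrite /T -opolyB /cpoly -rmorphB; apply: cpoly_norm_le => [|t tab].
    by rewrite divr_ge0.
  rewrite hornerD hornerN; have := Hq n t tab; have := Hq k t tab.
  have : k.+1%:R^-1 <= n.+1%:R^-1 :> R by rewrite lef_pV2 ?posrE ?ltr0n // ler_nat ltnS.
  have := ler_distD (g t) (q n).[t] (q k).[t]; rewrite (distrC (g t)).
  by set u := n.+1%:R^-1; set v := k.+1%:R^-1; lra.
have {}/choice [S HS] : forall x, exists y,
    forall n, ell2_norm (T n x - y) <= (2 * ell2_norm x) / n.+1%:R.
  move=> x; apply: ell2_cauchy_rate; first by rewrite mulr_ge0 ?ell2_norm_ge0.
  by move=> n k nk; rewrite (le_trans (Tdist n k nk x)) // mulrAC.
have TS n : bounded_by (fun x => T n x - S x) (2 / n.+1%:R).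
  by move=> x; rewrite (le_trans (HS x n)) // mulrAC.
exists S; split.
- move=> c x y; apply/eqP; rewrite -subr_eq0; apply/eqP/ell2_norm_eq0/eqP.
  rewrite eq_le ell2_norm_ge0 andbT.
  apply: (@rate_le0 _ (2 * (ell2_norm (c *: x + y) + absC c * ell2_norm x + ell2_norm y))).
  move=> n.
  have -> : S (c *: x + y) - (c *: S x + S y) =
      - (T n (c *: x + y) - S (c *: x + y)) + (c *: (T n x - S x) + (T n y - S y)).
    by rewrite /T opoly_linear; apply: ell2_eqP => j; rewrite !ell2E; ring.
  apply: (le_trans (ell2_normD _ _)); rewrite ell2_normN.
  have H1 := TS n (c *: x + y); have H2 := TS n x; have H3 := TS n y.
  have H4 := ell2_normD (c *: (T n x - S x)) (T n y - S y).
  have H5 := ell2_normZ_le c (T n x - S x).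
  have H6 := ler_wpM2l (absC_ge0 c) H2.
  rewrite [leRHS]mulrAC; move: H1 H3 H6; rewrite /=; set u := 2 / n.+1%:R => H1 H3 H6.
  rewrite !mulrDr [u * (absC _ * _)]mulrCA; lra.
- have [c c0 Tc] := poly_bounded (cpoly (q 0%N)).
  apply: (@le_lt_trans _ _ (c + 2)%:E); last exact: ltry.
  apply: opnorm_le => [|x]; first by rewrite addr_ge0.
  have -> : S x = T 0%N x - (T 0%N x - S x) by rewrite opprB addrC subrK.
  rewrite (le_trans (ell2_normD _ _)) // ell2_normN mulrDl lerD //; first exact: Tc.
  by have := TS 0%N x; rewrite invr1 mulr1.
- move=> e e0; have [n _ Hn] := @rate_small R 2 e 0%N (ler0n _ 2) e0.
  exists (q n); split=> [t tab|x].
    apply: (le_trans (Hq n t tab)); apply: le_trans Hn.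
    by rewrite ler_pMl ?invr_gt0 ?ltr0n // ler1n.
  by rewrite (le_trans (TS n x)) // ler_wpM2r ?ell2_norm_ge0.
Qed.

(** For t outside [a, b] the function 1 / (s - t) is continuous on [a, b], and
    the corresponding limit of polynomials is the resolvent at t. *)
Lemma spectrum_sub (t : R) : spectrum W (ofR t) -> a <= t <= b.
Proof.
move=> Wt; apply: contrapT => /negP tab; apply: Wt.
have [S [linS Sfin HS]] := operator_limit (cont_on_inv tab).
pose SL : {linear H -> H} := HB.pack S (GRing.isLinear.Build _ _ _ _ S linS).
exists SL; rewrite /=.
have [B B0 WB] := opnorm_fin_bounded W_linear W_bounded.
pose m := `|a| + `|b| + `|t|.
have tm s : a <= s <= b -> `|s - t| <= m.
  move=> sab; apply: (le_trans (ler_normB _ _)); rewrite /m lerD2r ler_norml.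
  have := ler_norm b; have := ler_norm (- a); rewrite normrN.
  have := normr_ge0 a; have := normr_ge0 b; case/andP: sab => *; apply/andP; split; lra.
have inv_approx (q : {poly R}) e : (forall s, a <= s <= b -> `|q.[s] - (s - t)^-1| <= e) ->
    0 <= e -> bounded_by (opoly W (cpoly (q * ('X - t%:P) - 1))) (e * m).
  move=> qe e0; apply: cpoly_norm_le => [|s sab]; first by rewrite mulr_ge0 ?addr_ge0.
  rewrite !hornerE.
  have st : s - t != 0 by apply: contraNneq tab => /eqP; rewrite subr_eq0 => /eqP <-.
  have -> : q.[s] * (s - t) - 1 = (q.[s] - (s - t)^-1) * (s - t).
    by rewrite mulrBl mulVf.
  by rewrite normrM ler_pM // ?qe // tm.
have shiftE x : opoly W (cpoly ('X - t%:P)) x = W x - ofR t *: x.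
  by rewrite /cpoly map_polyXsubC opoly_XsubC.
have opE (q : {poly R}) x : opoly W (cpoly (q * ('X - t%:P) - 1)) x =
    opoly W (cpoly q) (W x - ofR t *: x) - x.
  by rewrite -shiftE -opolyM /cpoly rmorphB rmorphM rmorph1 opolyB opolyC scale1r.
have vanish x (c : R) : 0 <= c -> (forall e, 0 < e -> ell2_norm x <= e * c) -> x = 0.
  move=> c0 xc; apply: ell2_norm_eq0; apply/eqP; rewrite eq_le ell2_norm_ge0 andbT.
  apply/ler_addgt0Pr => e e0; rewrite add0r.
  apply: (le_trans (xc (e / (c + 1)) _)); first by rewrite divr_gt0 // ltr_wpDl.
  by rewrite mulrAC ler_pdivrMr ?ltr_wpDl // ler_wpM2l ?(ltW e0) // ler_wpDr.
split=> // x; apply/eqP; rewrite -subr_eq0; apply/eqP.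
  apply: (vanish _ (ell2_norm (W x - ofR t *: x) + m * ell2_norm x)).
    by rewrite addr_ge0 ?mulr_ge0 ?ell2_norm_ge0 ?addr_ge0.
  move=> e e0; have [q [qe qS]] := HS e e0.
  set y := W x - _ in qS *.
  have -> : S y - x = - (opoly W (cpoly q) y - S y) + (opoly W (cpoly q) y - x).
    by rewrite opprB addrA subrK.
  rewrite -opE [leRHS]mulrDr (le_trans (ell2_normD _ _)) // ell2_normN lerD //.
  by rewrite mulrA inv_approx // ltW.
apply: (vanish _ ((B + `|t|) * ell2_norm x + m * ell2_norm x)).
  by rewrite addr_ge0 ?mulr_ge0 ?ell2_norm_ge0 ?addr_ge0.
move=> e e0; have [q [qe qS]] := HS e e0.
set y := opoly W (cpoly q) x - S x.
have -> : W (S x) - ofR t *: S x - x =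
    - (W y - ofR t *: y) + (opoly W (cpoly q) (W x - ofR t *: x) - x).
  have -> : W x - ofR t *: x = (- ofR t) *: x + W x by rewrite scaleNr addrC.
  have -> : W y = W (opoly W (cpoly q) x) - W (S x) by exact: linearB.
  rewrite opoly_linear -opoly_comm /y.
  by apply: ell2_eqP => j; rewrite !ell2E; ring.
rewrite -opE [leRHS]mulrDr (le_trans (ell2_normD _ _)) // ell2_normN lerD //; last first.
  by rewrite mulrA inv_approx // ltW.
have yx : ell2_norm y <= e * ell2_norm x by exact: qS.
rewrite (le_trans (ell2_normD _ _)) // ell2_normN.
have H1 := WB y; have := ell2_normZ_le (ofR t) y; rewrite absC_ofR => H2.
have : (B + `|t|) * ell2_norm y <= (B + `|t|) * (e * ell2_norm x).
  by rewrite ler_wpM2l // addr_ge0.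
rewrite !mulrDl mulrDr; lra.
Qed.

Definition bounded_below p := exists2 c : R, 0 < c &
  forall N x, supported_in N N x -> c * ell2_norm x <= ell2_norm (opoly W p x).

(** The quadrature nodes are real, hence at distance at least |Im z| from z. *)
Lemma bounded_below_nonreal (z : C) : complex.Im z != 0 ->
  bounded_below ('X - z%:P).
Proof.
move=> z0; exists `|complex.Im z|; first by rewrite normr_gt0.
move=> N x sx; have [n [t [w [tw E]]]] := W_quadrature 1 sx.
rewrite -(@ler_pXn2r _ 2) ?nnegrE ?mulr_ge0 ?ell2_norm_ge0 // exprMn.
have -> := E ('X - z%:P) ltac:(by rewrite size_XsubC).
rewrite (quadrature_mass E) mulr_sumr; apply: ler_sum => i _.
rewrite ler_wpM2r ?(tw i).2 // real_normK ?num_real // hornerXsubC absC_sqr.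
by case: z {z0} => u v /=; rewrite sub0r sqrrN lerDr sqr_ge0.
Qed.

Lemma bounded_below_resolvent (z : C) : ~ spectrum W z ->
  bounded_below ('X - z%:P).
Proof.
move=> /contrapT [S [Sfin SW _]].
have linS : linear S by move=> c x y; rewrite linearP.
have [c c0 Sc] := opnorm_fin_bounded linS Sfin.
exists (c + 1)^-1; first by rewrite invr_gt0 ltr_wpDl.
move=> N x _; rewrite opoly_XsubC mulrC ler_pdivrMr ?ltr_wpDl //.
rewrite -{1}[x]SW mulrC (le_trans (Sc _)) // ler_wpM2r ?ell2_norm_ge0 //.
by rewrite lerDl.
Qed.

Lemma bounded_belowM p q : bounded_below p -> bounded_below q -> bounded_below (p * q).
Proof.
move=> [c c0 pc] [d d0 qd]; exists (c * d); first exact: mulr_gt0.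
move=> N x sx; have [K sK] := W_finite q sx.
rewrite opolyM (le_trans _ (pc _ _ sK)) // -mulrA ler_wpM2l ?(ltW c0) //.
exact: qd sx.
Qed.

Lemma bounded_below_const (z : C) : z != 0 -> bounded_below z%:P.
Proof.
move=> z0; have az0 : 0 < absC z.
  by rewrite lt_def absC_ge0 andbT; apply: contraNneq z0 => /absC_eq0 ->.
exists (absC z) => // N x _; rewrite opolyC.
have {1}-> : x = z^-1 *: (z *: x) by rewrite scalerA mulVf // scale1r.
rewrite -ler_pdivlMl // (le_trans (ell2_normZ_le _ _)) // ler_wpM2r ?ell2_norm_ge0 //.
by rewrite -[leRHS]mulr1 -absC1 -(mulfV z0) absCM mulKf // gt_eqF.
Qed.

(** Over the complex numbers p is a product of factors 'X - z. Each root z is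
    non-real or a real point of the resolvent set, and W - z is bounded below in
    both cases. *)
Lemma bounded_below_poly p : p != 0 ->
    (forall t : R, spectrum W (ofR t) -> p.[ofR t] != 0) -> bounded_below p.
Proof.
move=> p0 pspec; have [rs pE] := closed_field_poly_normal p.
have rootE z : z \in rs -> p.[z] = 0.
  move=> zr; apply/eqP; rewrite -/(root p z) pE rootZ ?lead_coef_eq0 //.
  by rewrite root_prod_XsubC.
rewrite pE -mul_polyC; apply: bounded_belowM.
  by apply: bounded_below_const; rewrite lead_coef_eq0.
elim: rs rootE {pE} => [|z rs IH] rootE.
  by rewrite big_nil; apply: bounded_below_const; rewrite oner_eq0.
rewrite big_cons; apply: bounded_belowM; last first.
  by apply: IH => y yr; apply: rootE; rewrite inE yr orbT.
have [z0|z0] := eqVneq (complex.Im z) 0; last exact: bounded_below_nonreal.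
apply: bounded_below_resolvent => Wz.
have zE : z = ofR (complex.Re z) by case: z z0 {Wz rootE} => u v /= ->.
have := pspec (complex.Re z); rewrite -zE => /(_ Wz).
by rewrite rootE ?eqxx // mem_head.
Qed.

(** Let M be the norm of T = r(W) and suppose s < M. No root of r^2 - M^2 is a
    real point of the spectrum, so (r^2 - M^2)(W) is a product of operators
    bounded below. On the other hand the square of the norm of (T^2 - M^2) x is
    at most M^2 (M^2 |x|^2 - |T x|^2), so boundedness below keeps |T x| away from
    M |x|, against the choice of M. The disjunction excludes r^2 = M^2, which
    could happen for a constant r if the spectrum were empty. *)
Lemma spectral_bound_aux r (s : R) : 0 <= s ->
    (forall t, spectrum W (ofR t) -> `|r.[t]| <= s) ->
    (1 < size r)%N \/ (exists t, spectrum W (ofR t)) ->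
  bounded_by (opoly W (cpoly r)) s.
Proof.
move=> s0 rs rnc; pose T := opoly W (cpoly r).
have linT : linear T by exact: opoly_linear.
have [B B0 TB] := poly_bounded (cpoly r).
have Tnum : opnorm T \is a fin_num.
  rewrite ge0_fin_numE ?(le_lt_trans (opnorm_le B0 TB)) ?ltry //.
  apply: ereal_sup_ubound; exists 0 => /=; first by rewrite ell2_norm0.
  by rewrite (linearT0 linT) ell2_norm0.
pose M := fine (opnorm T).
have TM : bounded_by T M by apply: opnorm_bounded; rewrite ?fineK.
have Mmin c : 0 <= c -> bounded_by T c -> M <= c.
  by move=> c0 Tc; rewrite -lee_fin fineK // opnorm_le.
have [Ms|sM] := leP M s.
  by move=> x; rewrite (le_trans (TM x)) // ler_wpM2r ?ell2_norm_ge0.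
exfalso; have M0 : 0 < M by exact: le_lt_trans sM.
pose p := r ^+ 2 - (M ^+ 2)%:P.
have pE t : p.[t] = r.[t] ^+ 2 - M ^+ 2 by rewrite /p !hornerE.
have pspec t : spectrum W (ofR t) -> p.[t] != 0.
  move=> /rs rt; rewrite pE subr_eq0 lt_eqF //.
  rewrite -(real_normK (num_real _)) ltrXn2r ?nnegrE ?(ltW M0) //.
  exact: le_lt_trans sM.
have p0 : p != 0.
  case: rnc => [r1|[t /pspec]]; last by apply: contraNneq => ->; rewrite horner0.
  rewrite subr_eq0; apply: contraTneq r1 => r2; rewrite -leqNgt.
  have := congr1 (size \o polyseq) r2; rewrite /= size_polyC.
  have [->|r0] := eqVneq r 0; first by rewrite size_poly0.
  rewrite expr2 size_mul //; case: (M ^+ 2 != 0) => /=; move: (size r) => l; lia.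
have [c c0 pc] : bounded_below (cpoly p).
  apply: bounded_below_poly => [|t Wt]; first by rewrite map_poly_eq0.
  by rewrite horner_cpoly fmorph_eq0 pspec.
(* M^2 |x|^2 - |T x|^2 >= (c / M)^2 |x|^2, so the norm of T is at most sqrt e. *)
pose e := M ^+ 2 - (c / M) ^+ 2.
have TxE N x : supported_in N N x -> ell2_norm (T x) ^+ 2 <= e * ell2_norm x ^+ 2.
  move=> sx.
  pose l := maxn (size (cpoly r * cpoly r)) (maxn (size (cpoly p)) (size (cpoly r))).
  have [n [t [w [tw E]]]] := W_quadrature l sx.
  have TE : ell2_norm (T x) ^+ 2 = \sum_i r.[t i] ^+ 2 * w i.
    rewrite E; last by rewrite leqW // !leq_max leqnn ?orbT.
    by apply: eq_bigr => i _; rewrite horner_cpoly absC_ofR real_normK ?num_real.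
  have TTE : ell2_norm (T (T x)) ^+ 2 = \sum_i r.[t i] ^+ 4 * w i.
    rewrite /T -opolyM E; last by rewrite leqW // !leq_max leqnn ?orbT.
    apply: eq_bigr => i _; rewrite hornerM absCM horner_cpoly absC_ofR.
    by rewrite -normrM real_normK ?num_real //; ring.
  have XE : ell2_norm x ^+ 2 = \sum_i w i by exact: quadrature_mass E.
  have pxE : ell2_norm (opoly W (cpoly p) x) ^+ 2 =
      ell2_norm (T (T x)) ^+ 2 - 2 * M ^+ 2 * ell2_norm (T x) ^+ 2 + M ^+ 4 * ell2_norm x ^+ 2.
    rewrite E; last by rewrite leqW // !leq_max leqnn ?orbT.
    rewrite TTE TE XE !mulr_sumr -sumrB -big_split; apply: eq_bigr => i _ /=.
    by rewrite horner_cpoly absC_ofR real_normK ?num_real // pE; ring.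
  have H1 : c ^+ 2 * ell2_norm x ^+ 2 <= ell2_norm (opoly W (cpoly p) x) ^+ 2.
    by rewrite -exprMn lerXn2r ?nnegrE ?mulr_ge0 ?ell2_norm_ge0 ?(ltW c0) // (pc N).
  have H2 : ell2_norm (T (T x)) ^+ 2 <= M ^+ 2 * ell2_norm (T x) ^+ 2.
    by rewrite -exprMn lerXn2r ?nnegrE ?mulr_ge0 ?ell2_norm_ge0 ?(ltW M0).
  have M20 : 0 < M ^+ 2 by rewrite exprn_gt0.
  rewrite -(ler_pM2l M20) /e.
  move: H1 H2; rewrite pxE; set X := ell2_norm x ^+ 2; set Y := ell2_norm (T x) ^+ 2.
  have -> : M ^+ 2 * ((M ^+ 2 - (c / M) ^+ 2) * X) = M ^+ 4 * X - c ^+ 2 * X.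
    by field; rewrite gt_eqF.
  lra.
have TM' : bounded_by T (Num.sqrt e).
  apply: (bounded_by_dense linT TB (sqrtr_ge0 _)) => N x sx.
  have [e0|e0] := leP 0 e.
    rewrite -(@ler_pXn2r _ 2) ?nnegrE ?mulr_ge0 ?ell2_norm_ge0 ?sqrtr_ge0 // exprMn.
    by rewrite (sqr_sqrtr e0) (TxE N).
  have : ell2_norm (T x) ^+ 2 <= 0.
    by rewrite (le_trans (TxE N x sx)) // mulr_le0_ge0 ?sqr_ge0 // ltW.
  by rewrite exprn_even_le0 //= => /eqP ->; rewrite mulr_ge0 ?sqrtr_ge0 ?ell2_norm_ge0.
have := Mmin _ (sqrtr_ge0 _) TM'; apply/negP; rewrite -ltNge.
have eM : e < M ^+ 2 by rewrite /e gtrBl exprn_gt0 // divr_gt0.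
have [e0|e0] := leP 0 e; last by rewrite ltr0_sqrtr.
by rewrite -[ltRHS]ger0_norm ?(ltW M0) // -sqrtr_sqr ltr_sqrt // exprn_gt0.
Qed.

(** Otherwise [spectral_bound_aux] applies to the polynomial 'X with the bound
    0, so W = 0; but 0 is in the spectrum of the zero operator. *)
Lemma spectrum_nonempty : exists t, spectrum W (ofR t).
Proof.
apply: contrapT => /forallNP W0.
have W_0 x : W x = 0.
  have H0 : bounded_by (opoly W (cpoly 'X)) 0.
    apply: spectral_bound_aux => // [t /W0 //|]; by left; rewrite size_polyX.
  have := H0 x; rewrite /cpoly map_polyX opolyX mul0r => Wx.
  by apply: ell2_norm_eq0; apply/eqP; rewrite eq_le Wx ell2_norm_ge0.
have /contrapT [S [_ _ WS]] := W0 0.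
have := congr1 (fun x : H => x 0) (WS (ell2_basis R 0)).
rewrite W_0 /ofR rmorph0 scale0r subr0 ell20 ell2_basisE eqxx => /esym/eqP.
by rewrite oner_eq0.
Qed.

Lemma spectral_bound r (s : R) : 0 <= s ->
    (forall t, spectrum W (ofR t) -> `|r.[t]| <= s) ->
  bounded_by (opoly W (cpoly r)) s.
Proof.
by move=> s0 rs; apply: spectral_bound_aux => //; right; exact: spectrum_nonempty.
Qed.

(** Existence of the calculus is [operator_limit] and [spectrum_sub]. The
    operator [funcalc f W] is tied only to polynomials p close to f on the
    spectrum; [spectral_bound] compares such p with a q close to f on all of
    [a, b]. *)
Lemma funcalcP f (e : R) : cont_on a b f -> 0 < e ->
  exists q : {poly R}, (forall t, a <= t <= b -> `|q.[t] - f t| <= e) /\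
    bounded_by (fun x => opoly W (cpoly q) x - funcalc f W x) e.
Proof.
move=> fc e0.
have [linS Sfin HS] : is_funcalc f W (funcalc f W).
  apply: xgetPex; have [S [linS Sfin HS]] := operator_limit fc.
  exists S; split => // d d0; have [q [qf qS]] := HS d d0; exists q; split.
    by move=> t /spectrum_sub; exact: qf.
  apply: opnorm_le => [|x]; first exact: ltW.
  by rewrite polyop_opoly; exact: qS.
have e4 : 0 < e / 4 by rewrite divr_gt0.
have [p [pf pS]] := HS _ e4.
have [q qf] := weierstrass ab e4 fc.
exists q; split=> [t tab|x]; first by rewrite (le_trans (qf t tab)) //; lra.
have linpS : linear (fun x => polyop p W x - funcalc f W x).
  move=> c y z; rewrite !polyop_opoly opoly_linear linS.
  by apply: ell2_eqP => j; rewrite !ell2E; ring.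
have pSx := opnorm_bounded linpS pS x; rewrite polyop_opoly in pSx.
have qp : bounded_by (opoly W (cpoly (q - p))) (e / 2).
  apply: spectral_bound => [|t Wt]; first by rewrite divr_ge0 // ltW.
  rewrite hornerD hornerN; have := pf t Wt; have := qf t (spectrum_sub Wt).
  have := ler_distD (f t) q.[t] p.[t]; rewrite (distrC (f t)); lra.
have qpx : ell2_norm (opoly W (cpoly q) x - opoly W (cpoly p) x) <= e / 2 * ell2_norm x.
  by rewrite -opolyB -rmorphB; exact: qp.
have := ell2_distD (opoly W (cpoly p) x) (opoly W (cpoly q) x) (funcalc f W x).
have := ell2_norm_ge0 x.
move=> x0 /le_trans; apply.
apply: (le_trans (lerD qpx pSx)); rewrite -mulrDl ler_wpM2r //; lra.
Qed.

End Calculus.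

(** * Convergence of the window powers *)

Section Convergence.
Variable R : realType.
Notation C := (Cplx R).
Notation H := (ell2 R).

Lemma cvgC_absC (T : Type) (F : set_system T) (FF : Filter F) (f : T -> C) (l : C) :
    (forall e : R, 0 < e -> \forall t \near F, absC (l - f t) <= e) ->
  f @ F --> l.
Proof.
move=> fl; apply/cvgrPdist_le => e e0.
have [re0 eE] : 0 < complex.Re e /\ e = ofR (complex.Re e).
  by case: e e0 => u v; rewrite ltcE /= => /andP[/eqP -> u0].
have := fl _ re0; apply: filterS => t tl.
by rewrite eE normC_absC lecR.
Qed.

Lemma restr_basis P Q (n : int) : - P%:Z <= n <= Q%:Z ->
  restr P Q (ell2_basis R n) = delta_mx (inord (absz (n + P%:Z))) ord0.
Proof.
move=> nPQ; apply/colP => i; rewrite !mxE ell2_basisE andbT.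
congr (_ %:R); congr (nat_of_bool _).
have -> : (i == inord (absz (n + P%:Z)) :> 'I_(P + Q).+1) = (i == absz (n + P%:Z) :> nat).
  by rewrite -val_eqE /= inordK //; lia.
by apply/eqP/eqP; lia.
Qed.

(** For the exponent alpha, [mxpow A alpha] is convertible to [mxfun A f] with
    f the power function. *)
Definition mxfun n (A : 'M[C]_n) (f : R -> R) : 'M[C]_n :=
  invmx (spectralmx A)
    *m diag_mx (map_mx (fun l => ofR (f (reC l))) (spectral_diag A))
    *m spectralmx A.

(** A polynomial q close to f on [a, b] links the two sides: its matrix elements
    at the window and at W coincide for large windows, while q is close to f on
    the eigenvalues of the window and q(W) is close to S. *)
Lemma mxfun_window_cvg (W : {linear H -> H}) (D : int -> int -> C) (k : nat)
    (a b : R) (f : R -> R) (S : H -> H) :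
    hermitianZ (mxelt W) -> hermitianZ D -> row_sparse k (mxelt W) ->
    (forall P Q, (0 < P)%N -> (0 < Q)%N -> forall i, exists2 t, a <= t <= b &
      spectral_diag (window P Q (mxelt W) D) ord0 i = ofR t) ->
    (forall e, 0 < e -> exists q : {poly R},
      (forall t, a <= t <= b -> `|q.[t] - f t| <= e) /\
      bounded_by (fun x => opoly W (cpoly q) x - S x) e) ->
  forall (m n : int) (e : R), 0 < e ->
    exists N, forall P Q, (N < P)%N -> (N < Q)%N ->
      absC (mxelt S m n - window_elt (mxfun (window P Q (mxelt W) D) f) m n) <= e.
Proof.
move=> W_herm D_herm W_sparse win_spec HS m n e e0.
have [q [qf qS]] := HS _ (divr_gt0 e0 (ltr0n _ 2)).
pose d := size (cpoly q); pose N0 := (absz m + absz n)%N.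
have [N N0N supN] := iter_supp_grow W_herm W_sparse d N0.
exists N => P Q NP NQ; set A := window P Q (mxelt W) D.
have nN : - N0%:Z <= n <= N0%:Z by rewrite /N0; lia.
have nPQ : - P%:Z <= n <= Q%:Z by lia.
have mPQ : - P%:Z <= m <= Q%:Z by move: N0N; rewrite /N0; lia.
have iE : nat_of_ord (inord (absz (m + P%:Z)) : 'I_(P + Q).+1) = absz (m + P%:Z).
  by rewrite inordK //; lia.
have qE : window_elt (horner_mx A (cpoly q)) m n = opoly W (cpoly q) (ell2_basis R n) m.
  have := restr_opoly D NP NQ (supN _ (supported_in_basis R nN)) (leqnSn d).
  move=> /colP/(_ (inord (absz (m + P%:Z)))); rewrite restr_basis // -/A -colE !mxE iE => qE.
  rewrite /window_elt -qE; congr (opoly _ _ _ _); lia.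
have A_normal : A \is normalmx by exact: window_normal.
set F := mxfun A f.
rewrite mxeltE.
have -> : S (ell2_basis R n) m - window_elt F m n =
    - ((opoly W (cpoly q) (ell2_basis R n) - S (ell2_basis R n)) m) +
    window_elt (horner_mx A (cpoly q) - F) m n.
  have -> : window_elt (horner_mx A (cpoly q) - F) m n =
      window_elt (horner_mx A (cpoly q)) m n - window_elt F m n.
    by rewrite /window_elt !mxE.
  by rewrite qE ell2B opprB addrA subrK.
apply: (le_trans (absCD _ _)); rewrite absCN [leRHS]splitr; apply: lerD.
  apply: (le_trans (ell2_coord _ _)); apply: (le_trans (qS _)).
  by rewrite ler_piMr ?ell2_norm_basis // divr_ge0 // ltW.
rewrite horner_normalmx // /F /mxfun -mulmxBl -mulmxBr -raddfB.
apply: normal_entry_bound => [|i]; first by rewrite divr_ge0 // ltW.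
have [t tab tE] := win_spec P Q (leq_ltn_trans (leq0n _) NP) (leq_ltn_trans (leq0n _) NQ) i.
rewrite !mxE tE horner_cpoly /ofR -rmorphB -/(ofR _) absC_ofR.
exact: qf.
Qed.

End Convergence.

Theorem theorem1 (R : realType)
    (W : {linear ell2 R -> ell2 R}) (D : int -> int -> Cplx R)
    (W_herm : hermitianZ (mxelt W))
    (W_bounded : (opnorm W < +oo)%E)
    (k : nat) (k_gt0 : (0 < k)%N) (W_sparse : row_sparse k (mxelt W))
    (W_ge0 : 0 <= inf_spectrum W)
    (D_herm : hermitianZ D)
    (d : R) (d_ge0 : 0 <= d)
    (window_ge : forall P Q : nat, (0 < P)%N -> (0 < Q)%N ->
      forall a : Cplx R, eigenvalue (window P Q (mxelt W) D) a ->
        ofR (inf_spectrum W) <= a)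
    (window_le : forall P Q : nat, (0 < P)%N -> (0 < Q)%N ->
      (mx_opnorm (window P Q (mxelt W) D) <= opnorm W + d%:E)%E)
    (alpha : R)
    (alpha_ok : 0 < inf_spectrum W \/ (inf_spectrum W = 0 /\ 0 <= alpha)) :
  forall m n : int,
    window_elt (mxpow (window PQ.1 PQ.2 (mxelt W) D) alpha) m n
      @[PQ --> (\oo, \oo)]
    --> mxelt (oppow W alpha) m n.
Proof.
move=> m n; set a := inf_spectrum W in W_ge0 window_ge alpha_ok *.
have W_linear : linear W by move=> c x y; rewrite linearP.
have [M M0 WM] := opnorm_fin_bounded W_linear W_bounded.
(* M + d bounds the norms of all windows; a + 1 only ensures a < b. *)
pose b := M + d + a + 1.
have ab : a < b by rewrite /b; lra.
have win_spec P Q : (0 < P)%N -> (0 < Q)%N -> forall i, exists2 t, a <= t <= b &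
    spectral_diag (window P Q (mxelt W) D) ord0 i = ofR t.
  move=> P0 Q0 i; set A := window P Q _ D.
  have A_normal : A \is normalmx by exact: window_normal.
  have := window_ge P Q P0 Q0 _ (spectral_diag_eigen i A_normal).
  have : absC (spectral_diag A ord0 i) <= M + d.
    apply: spectral_diag_norm => //; apply: (le_trans (window_le P Q P0 Q0)).
    by rewrite EFinD leeD2r // opnorm_le.
  rewrite -/A; case: (spectral_diag A ord0 i) => u v /= uM.
  rewrite lecE /= => /andP[/eqP v0 au]; exists u; last by rewrite v0.
  rewrite au /b /=; have := le_trans (ge_Re_absC _) uM.
  have := ler_norm u; rewrite /=; lra.
have W_finite N x (p : {poly Cplx R}) : supported_in N N x ->
    exists K, supported_in K K (opoly W p x).
  move=> sx; have [K _ HK] := iter_supp_grow W_herm W_sparse (size p) N.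
  by exists K; exact: opoly_supp (HK x sx) (leqnSn _).
have W_quadrature := quadrature W_herm D_herm W_sparse win_spec.
have fc := cont_on_powR (b := b) alpha_ok.
have fS := fun e => funcalcP W_bounded ab W_finite W_quadrature (e := e) fc.
apply: cvgC_absC => e e0.
have [N HN] := mxfun_window_cvg W_herm D_herm W_sparse win_spec fS m n e0.
exists ([set P | (N < P)%N], [set Q | (N < Q)%N]) => [|[P Q] [/= NP NQ]].
  by split; exists N.+1.
exact: HN.
Qed.
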